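(* Let $m\ge 3$ and $W=I_2(m)$. The complete list of quasiparabolic Gelfand models of $W$ is the following. (i) If $m$ is odd, choose $\mathrm{Ind}_{\langle s\rangle}^W\mathbf 1$ or $\mathrm{Ind}_{\langle s\rangle}^W(\mathrm{sgn}|_{\langle s\rangle})$, and append the missing linear character. There are two models. (ii) If $m$ is even, choose one of the four distinct reflection-induced characters $\mathrm{Ind}_{\langle u\rangle}^W\xi$, $u\in\{s,t\}$, $\xi(u)=\pm1$. Append the two missing linear characters, either split or joined. This gives eight models. (iii) If $m\equiv 2\pmod 4$, there are eight additional models. Put $z=(st)^{m/2}$. Choose a character induced from $\langle z,s\rangle$ (by the restriction of a linear character of $W$) that contains all odd-indexed $\rho_h$ and one of $\lambda_{+-},\lambda_{-+}$. Choose a second such character containing all even-indexed $\rho_h$ and one of $\lambda_{++},\lambda_{--}$. Append the remaining two linear characters, split or joined. Thus the numbers of models are $2$, $8$, $16$ according as $m$ is odd, divisible by four, or congruent to two modulo four.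
   Context: $I_2(m)=\langle s,t:s^2=t^2=(st)^m=1\rangle$ with simple generators $s,t$; $r=st$. Its two-dimensional irreducible characters are $\rho_h$, $1\le h<m/2$, with $\rho_h(r^j)=2\cos(2\pi hj/m)$, $\rho_h(r^js)=0$. For odd $m$ the linear characters are $\mathbf 1,\mathrm{sgn}$; for even $m$ they are $\lambda_{ab}$, $a,b\in\{\pm1\}$, with $\lambda_{ab}(s)=a$, $\lambda_{ab}(t)=b$. A pair of distinct linear characters $\{\lambda,\mu\}$ is split if it is used as two terms $\lambda$, $\mu$, and joined if it is used as one term $\lambda+\mu=\mathrm{Ind}_{\ker(\lambda\mu)}^W(\lambda|_{\ker(\lambda\mu)})$. For a finite Coxeter system $(W,S)$ with length $\ell$, reflections $T=\{wxw^{-1}:w\in W,x\in S\}$, $W_J=\langle J\rangle$: a scaled $W$-set is a $W$-set $X$ with $h:X\to\mathbb Z$ such that $|h(sx)-h(x)|\le 1$ for $s\in S$. It is quasiparabolic (QP) if for all $x\in X$, $r\in T$, $s\in S$: (QP1) $h(rx)=h(x)$ implies $rx=x$; (QP2) $h(rx)>h(x)$ and $h(srx)<h(sx)$ imply $rx=sx$. A subgroup $H\le W_J$ is quasiparabolic if $W_J/H$ with $h(wH)=\min_{u\in wH}\ell(u)$ is quasiparabolic for $(W_J,J)$. An allowed character is $\mathrm{Ind}_H^W(\sigma|_H)$ with $J\subseteq S$, $H\le W_J$ quasiparabolic, $\sigma$ a one-dimensional complex character of $W_J$. A quasiparabolic Gelfand model is an unordered family (multiset) of allowed characters with sum $\Gamma_W=\sum_{\rho\in\mathrm{Irr}(W)}\rho$;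 families are identified if their individual induced characters agree after reordering. *)

(* Defs.v *)
From HB Require Import structures.
From mathcomp Require Import all_boot all_order all_fingroup all_algebra.
From mathcomp Require Import all_solvable all_field all_character.
From mathcomp Require Import finmap multiset.

Set Implicit Arguments.
Unset Strict Implicit.
Unset Printing Implicit Defensive.

Import GroupScope Order.TTheory GRing.Theory Num.Theory.
Local Open Scope ring_scope.
Local Open Scope mset_scope.

Definition has_exactly (K : eqType) (n : nat) (P : K -> Prop) : Prop :=
  exists L : seq K, [/\ uniq L, size L = n & forall x, P x <-> x \in L].

(* In a finite group the relations, generation and the isomorphism type
   together say that s, t are the generators of the presentation. *)
Definition dihedral_presentation (m : nat) (gT : finGroupType)
    (W : {group gT}) (s t : gT) : Prop :=
  [/\ W \isog Grp (x : y : x ^+ 2, y ^+ 2, (x * y) ^+ m),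
      <<[set s; t]>>%g = W,
      (s ^+ 2 = 1)%g, (t ^+ 2 = 1)%g & ((s * t) ^+ m = 1)%g].

Section CoxeterSystem.

Variables (gT : finGroupType) (S : {set gT}).

Definition refls : {set gT} := [set (w * x * w^-1)%g | w in <<S>>%g, x in S].

(* (S ^+ n)%g is the set of values of words of n letters in S. An element of
   <<S>> has length < #|<<S>>| <= #|gT|, so the search always succeeds. *)
Definition cox_length (w : gT) : nat :=
  find (fun n => w \in (S ^+ n)%g) (iota 0 #|gT|).

(* cox_length is bounded by #|gT|, so the default value is harmless on a
   nonempty A. *)
Definition min_length (A : {set gT}) : nat :=
  \big[minn/#|gT|]_(u in A) cox_length u.

(* Left actions of <<S>> on the carrier D; MathComp's own actions are right
   actions. *)
Definition scaled_set (X : Type) (D : {pred X}) (act : gT -> X -> X)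
    (h : X -> int) : Prop :=
  [/\ forall w x, w \in <<S>>%g -> x \in D -> act w x \in D,
      forall x, x \in D -> act 1%g x = x,
      forall v w x, v \in <<S>>%g -> w \in <<S>>%g -> x \in D ->
        act (v * w)%g x = act v (act w x)
    & forall s x, s \in S -> x \in D -> `|h (act s x) - h x| <= 1].

Definition quasiparabolic (X : Type) (D : {pred X}) (act : gT -> X -> X)
    (h : X -> int) : Prop :=
  [/\ scaled_set D act h,
      forall x r, x \in D -> r \in refls -> h (act r x) = h x -> act r x = x
    & forall x r s, x \in D -> r \in refls -> s \in S ->
        h (act r x) > h x -> h (act s (act r x)) < h (act s x) ->
        act r x = act s x].

End CoxeterSystem.

Definition qp_subgroup (gT : finGroupType) (J : {set gT})
    (H : {group gT}) : Prop :=
  H \subset <<J>>%g /\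
  quasiparabolic J (mem (lcosets H <<J>>%g)) (fun w (C : {set gT}) => w *: C)%g
    (fun C => (min_length J C)%:Z).

Definition allowed_char (gT : finGroupType) (W : {group gT}) (S : {set gT})
    (chi : 'CF(W)) : Prop :=
  exists (J : {set gT}) (H : {group gT}) (sigma : 'CF(<<J>>)),
    [/\ J \subset S, qp_subgroup J H, sigma \is a linear_char
      & chi = 'Ind[W, H] ('Res[H] sigma)].

Definition qp_gelfand_model (gT : finGroupType) (W : {group gT})
    (S : {set gT}) (M : {mset 'CF(W)}) : Prop :=
  (forall chi, chi \in M -> allowed_char S chi) /\
  \sum_(chi <- M) chi = \sum_(i : Iirr W) 'chi_i.

Section Dihedral.

Variables (m : nat) (gT : finGroupType) (W : {group gT}) (s t : gT).

(* m.-root (-1) = e^(i pi / m), so this is 2 cos (2 pi k / m). *)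
Definition two_cos (k : nat) : algC := 2 * 'Re ((m.-root (-1)) ^+ (2 * k)).

Definition is_rho (h : nat) (i : Iirr W) : Prop :=
  forall j : nat, 'chi_i ((s * t) ^+ j)%g = two_cos (h * j) /\
                  'chi_i ((s * t) ^+ j * s)%g = 0.

Definition is_lambda (a b : algC) (i : Iirr W) : Prop :=
  [/\ 'chi_i \is a linear_char, 'chi_i s = a & 'chi_i t = b].

Definition contains_rho (chi : 'CF(W)) (h : nat) : Prop :=
  exists2 i : Iirr W, is_rho h i & i \in irr_constt chi.

Definition contains_lambda (chi : 'CF(W)) (a b : algC) : Prop :=
  exists2 i : Iirr W, is_lambda a b i & i \in irr_constt chi.

Definition is_sgn (sigma : 'CF(W)) : Prop :=
  [/\ sigma \is a linear_char, sigma s = -1 & sigma t = -1].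

Definition missing_linear (chi : 'CF(W)) : {set Iirr W} :=
  [set i | ('chi_i \is a linear_char) && (i \notin irr_constt chi)].

Definition joined (lam mu chi : 'CF(W)) : Prop :=
  chi = lam + mu /\
  chi = 'Ind[W, cfker (lam * mu)] ('Res[cfker (lam * mu)] lam).

Definition append_two_missing (base : seq 'CF(W)) (M : {mset 'CF(W)}) : Prop :=
  exists i j : Iirr W,
    [/\ i != j, missing_linear (\sum_(chi <- base) chi) = [set i; j]
      & M = seq_mset (base ++ [:: 'chi_i; 'chi_j]) \/
        exists2 chi, joined 'chi_i 'chi_j chi & M = seq_mset (base ++ [:: chi])].

Definition odd_model (M : {mset 'CF(W)}) : Prop :=
  exists (sigma : 'CF(W)) (i : Iirr W),
    let chi := 'Ind[W, <[s]>] ('Res[<[s]>] sigma) in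
    [/\ sigma = 1 \/ is_sgn sigma, missing_linear chi = [set i]
      & M = seq_mset [:: chi; 'chi_i]].

Definition reflection_induced (chi : 'CF(W)) : Prop :=
  exists (u : gT) (xi : 'CF(<[u]>)),
    [/\ u \in [set s; t], xi \is a linear_char, xi u = 1 \/ xi u = -1
      & chi = 'Ind[W] xi].

Definition even_model (M : {mset 'CF(W)}) : Prop :=
  exists2 chi, reflection_induced chi & append_two_missing [:: chi] M.

Definition klein_induced (chi : 'CF(W)) : Prop :=
  let V := <<[set ((s * t) ^+ m./2)%g; s]>>%G in
  exists2 lam : 'CF(W), lam \is a linear_char & chi = 'Ind[W, V] ('Res[V] lam).

Definition extra_model (M : {mset 'CF(W)}) : Prop :=
  exists chi1 chi2 : 'CF(W),
    [/\ klein_induced chi1 /\ klein_induced chi2,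
        forall h, (0 < h)%N -> (2 * h < m)%N -> odd h -> contains_rho chi1 h,
        contains_lambda chi1 1 (-1) \/ contains_lambda chi1 (-1) 1,
        forall h, (0 < h)%N -> (2 * h < m)%N -> ~~ odd h -> contains_rho chi2 h
      & (contains_lambda chi2 1 1 \/ contains_lambda chi2 (-1) (-1)) /\
        append_two_missing [:: chi1; chi2] M].

End Dihedral.

(* Main.v *)
Require Import Defs.
From HB Require Import structures.
From mathcomp Require Import all_boot all_order all_fingroup all_algebra.
From mathcomp Require Import all_solvable all_field all_character.
From mathcomp Require Import finmap multiset.
From mathcomp Require Import lra zify.

(** Let [r = st] and let [R] be the rotation subgroup. Comparing the cosets [sH]
    and [tH], which both have height 1, shows that a quasiparabolic subgroup
    [H] of [W] lies in [R] or contains [s] or [t]; conversely, if [H] contains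
    [s] or [t], the cosets of [H] have pairwise distinct heights, which makes
    [H] quasiparabolic. So every allowed character is [Ind_H^W lam] for a linear
    character [lam] of [W] and such an [H].

    A nonlinear irreducible character is induced from a linear character [xi]
    of [R]. By Frobenius reciprocity its multiplicity in [Ind_H^W lam] is 0 or 2
    if [H] lies in [R], and otherwise it is 1 or 0 according as [lam] and [xi]
    agree on [H :&: R] or not. Since [lam] takes the values [1] and [-1], the
    member of a model containing [rho_1] (where [xi] is faithful) must have
    [H = <u>] or [H = <z, u>] with [u] in [{s, t}], and in the second case
    [lam z = -1] and [m = 2 mod 4]. In the first case it contains every [rho_h].
    In the second case it contains the odd-indexed ones, and the same argument
    for [rho_2] gives a member that contains the even-indexed ones. What is left
    is a sum of at most two linear characters, which are split or joined. *)

Set Implicit Arguments.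
Unset Strict Implicit.
Unset Printing Implicit Defensive.

Import GroupScope Order.TTheory GRing.Theory Num.Theory.
Local Open Scope ring_scope.
Local Open Scope mset_scope.

(** * Roots of unity and the value of [m.-root (-1)] *)

(** Put [(a, b) = (cos x, sin x)] and [(c, d) = (cos y, sin y)]. The hypotheses say
    [0 < x <= y <= pi]; the conclusion says that the angle [y - x] still lies in [[0, pi]] and has a
    larger cosine than [y]. *)
Lemma unit_circle_sub (R : realFieldType) (a b c d : R) :
    a ^+ 2 + b ^+ 2 = 1 -> c ^+ 2 + d ^+ 2 = 1 -> 0 <= b -> 0 <= d ->
    a < 1 -> c <= a ->
  0 <= d * a - c * b /\ c < c * a + d * b.
Proof.
move=> ab cd b0 d0 a1 ca; split.
  case: (lerP 0 a) => a0; case: (lerP 0 c) => c0; try nra.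
    have bd: b <= d by rewrite -(ler_sqr b0 d0); nra.
    nra.
  have db: d <= b by rewrite -(ler_sqr d0 b0); nra.
  nra.
case: (ltrgtP 0 c) => c0.
- have bd: b <= d by rewrite -(ler_sqr b0 d0); nra.
  nra.
- nra.
- subst c.
  have d1 : d = 1 by nra.
  have b_neq0 : b != 0 by apply/eqP => b1; subst b; nra.
  have : 0 < b by rewrite lt_neqAle eq_sym b_neq0.
  nra.
Qed.

Lemma unity_root_ReIm (n : nat) (v : algC) :
  (0 < n)%N -> v ^+ n = 1 -> 'Re v ^+ 2 + 'Im v ^+ 2 = 1 /\ v^-1 = v^*.
Proof.
move=> n_gt0 vn1; have nv: `|v| = 1.
  by apply/eqP; rewrite -(@pexpr_eq1 _ _ n) // -normrX vn1 normr1.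
by rewrite -normC2_Re_Im nv expr1n invC_norm nv expr1n invr1 mul1r.
Qed.

Lemma unity_root_div_Re (n : nat) (u v : algC) :
    (0 < n)%N -> u ^+ n = 1 -> v ^+ n = 1 -> u != 1 ->
    0 <= 'Im u -> 0 <= 'Im v -> 'Re v <= 'Re u ->
  0 <= 'Im (v / u) /\ 'Re v < 'Re (v / u).
Proof.
move=> n_gt0 un1 vn1 u_neq1 u_ge0 v_ge0 le_vu.
have [un uV] := unity_root_ReIm n_gt0 un1; have [vn _] := unity_root_ReIm n_gt0 vn1.
rewrite uV ImM ReM Re_conj Im_conj.
have u_lt1 : 'Re u < 1.
  have u_le1: 'Re u ^+ 2 <= 1.
    by rewrite -un lerDl -realEsqr Creal_Im.
  have u1 : 'Re u <= 1.
    rewrite real_leNgt ?Creal_Re ?rpred1 //; apply/negP => u_gt1.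
    have := le_lt_trans u_le1; move/(_ ('Re u ^+ 2)).
    by rewrite exprn_egt1 // => /(_ isT); rewrite ltxx.
  rewrite lt_neqAle u1 andbT; apply: contra u_neq1 => /eqP Ru1.
  move: un; rewrite Ru1 expr1n -[RHS]addr0 => /addrI/eqP; rewrite sqrf_eq0.
  by move=> /eqP Iu0; rewrite [u]Crect Ru1 Iu0 mulr0 addr0.
(* [algC] is only partially ordered, so the inequality is applied in its real subfield [algR]. *)
have := @unit_circle_sub algR (in_algR (Creal_Re u)) (in_algR (Creal_Im u))
  (in_algR (Creal_Re v)) (in_algR (Creal_Im v)).
case=> //; try by apply: val_inj.
move=> h1 h2; split.
  by rewrite mulrN addrC [_ * 'Im v]mulrC.
by rewrite mulrN opprK.
Qed.

(* Dividing by the root [u] closest to [1] on the upper half circle increases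
   the real part, so a root that is not a power of [u] would produce another
   one with a larger real part. *)
Lemma unity_root_max_Re_prim (n : nat) (u : algC) :
    (0 < n)%N -> u ^+ n = 1 -> u != 1 -> 0 <= 'Im u ->
    (forall v, v ^+ n = 1 -> v != 1 -> 0 <= 'Im v -> 'Re v <= 'Re u) ->
  n.-primitive_root u.
Proof.
move=> n_gt0 un1 u_neq1 u_ge0 umax.
have [eta prim_eta] := C_prim_root_exists n_gt0.
have eta1 i : (eta ^+ i) ^+ n = 1 by rewrite exprAC (prim_expr_order prim_eta) expr1n.
have genP v : v ^+ n = 1 -> 0 <= 'Im v -> exists k, v = u ^+ k.
  move=> /(prim_rootP prim_eta)[i0 ->] i0_ge0.
  pose Q (i : 'I_n) := (0 <= 'Im (eta ^+ i)) && [forall k : 'I_n, eta ^+ i != u ^+ k].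
  case Qi0: (Q i0); last first.
    move: Qi0; rewrite /Q i0_ge0 /= => /negbT/forallPn[k]; rewrite negbK => /eqP->.
    by exists k.
  have reQ (i : 'I_n) : Q i -> 'Re (eta ^+ i) \is Num.real by rewrite Creal_Re.
  case: (real_arg_maxP Qi0 reQ) => i Qi imax; exfalso.
  have [/andP[i_ge0 /forallP i_new]] := (Qi, reQ).
  have i_neq1: eta ^+ i != 1 by have := i_new (Ordinal n_gt0); rewrite expr0.
  have [vu_ge0 lt_vu] := unity_root_div_Re n_gt0 un1 (eta1 i) u_neq1 u_ge0 i_ge0
    (umax _ (eta1 i) i_neq1 i_ge0).
  have [|j def_j] := @prim_rootP _ _ _ prim_eta (eta ^+ i / u).
    by rewrite exprMn eta1 exprVn un1 mulfV ?oner_eq0.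
  have Qj : Q j.
    rewrite /Q -def_j vu_ge0; apply/forallP=> k; apply/eqP=> def_k.
    have lt_k : (k.+1 %% n < n)%N by rewrite ltn_mod.
    have /eqP[] := i_new (Ordinal lt_k); rewrite /= expr_mod //.
    rewrite exprSr -def_k divfK //.
    by apply: contraTneq (oner_neq0 algC) => u0; rewrite -un1 u0 expr0n gtn_eqF ?eqxx.
  by have := imax j Qj; rewrite -def_j /= real_leNgt ?Creal_Re // lt_vu.
have [k def_eta] : exists k, eta = u ^+ k.
  have eta_n : eta ^+ n = 1 by apply: prim_expr_order.
  have [eta_ge0 | eta_lt0] := boolP (0 <= 'Im eta); first exact: genP.
  have [_ etaV] := unity_root_ReIm n_gt0 eta_n.
  have [||k def_k] := genP eta^-1; first by rewrite exprVn eta_n invr1.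
    by rewrite etaV Im_conj oppr_ge0 ltW // real_ltNge ?Creal_Im ?rpred0.
  (* The conjugate [eta^-1] lies on the upper half circle, and [eta] is its power of exponent
     [n.-1]. *)
  exists (k * n.-1)%N; rewrite exprM -def_k; apply: (@mulIf _ (eta^-1)).
    by rewrite invr_eq0 (prim_root_eq0 prim_eta) -lt0n.
  rewrite -exprSr prednK // exprVn eta_n invr1 mulfV //.
  by rewrite (prim_root_eq0 prim_eta) -lt0n.
have [d prim_u dvd_d] := prim_order_exists n_gt0 un1.
suff -> : n = d by [].
apply/eqP; rewrite eqn_dvd dvd_d (prim_order_dvd prim_eta) def_eta.
by rewrite exprAC (prim_expr_order prim_u) expr1n eqxx.
Qed.

(** [m.-root (-1)] is the root of largest real part in the closed upper half plane. The nontrivial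
    [2 * m]-th root of unity [u] of largest real part there is primitive, so [u ^+ m = -1], and the
    two maximality properties give equal real parts. *)
Lemma prim_rootCN1 (m : nat) : (1 < m)%N -> (2 * m).-primitive_root (m.-root (-1) : algC).
Proof.
move=> m_gt1; have m_gt0 := ltnW m_gt1; have N_gt0 : (0 < 2 * m)%N by rewrite muln_gt0.
set w := m.-root (-1).
have w_m : w ^+ m = -1 by rewrite rootCK.
have w_N : w ^+ (2 * m) = 1 by rewrite mulnC exprM w_m sqrrN expr1n.
have w_neq1 : w != 1.
  apply/eqP=> w1; move: w_m; rewrite w1 expr1n => /eqP.
  by rewrite -subr_eq0 opprK (pnatr_eq0 _ 2).
have [eta prim_eta] := C_prim_root_exists N_gt0.
have eta1 i : (eta ^+ i) ^+ (2 * m) = 1.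
  by rewrite exprAC (prim_expr_order prim_eta) expr1n.
have w_ge0 : 0 <= 'Im w by apply: Im_rootC_ge0.
have [i0 def_i0] := prim_rootP prim_eta w_N.
pose P (i : 'I_(2 * m)) := (eta ^+ i != 1) && (0 <= 'Im (eta ^+ i)).
have Pi0 : P i0 by rewrite /P -def_i0 w_neq1.
have reP (i : 'I_(2 * m)) : P i -> 'Re (eta ^+ i) \is Num.real by rewrite Creal_Re.
case: (real_arg_maxP Pi0 reP) => i /andP[i_neq1 i_ge0] imax.
set u := eta ^+ i in i_neq1 i_ge0 imax *.
have umax v : v ^+ (2 * m) = 1 -> v != 1 -> 0 <= 'Im v -> 'Re v <= 'Re u.
  move=> /(prim_rootP prim_eta)[j ->] j_neq1 j_ge0.
  by apply: imax; rewrite /P j_neq1.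
have prim_u := unity_root_max_Re_prim N_gt0 (eta1 i) i_neq1 i_ge0 umax.
have u_m : u ^+ m = -1.
  have /eqP : (u ^+ m) ^+ 2 = 1 by rewrite -exprM mulnC eta1.
  rewrite sqrf_eq1 => /predU1P[um1|/eqP//].
  have : (2 * m %| m)%N by rewrite (prim_order_dvd prim_u) um1 eqxx.
  by move/(dvdn_leq m_gt0); rewrite leqNgt ltn_Pmull.
have eq_Re : 'Re w = 'Re u.
  by apply/le_anti; rewrite umax //= rootC_Re_max.
suff -> : w = u by [].
rewrite [w]Crect [u]Crect eq_Re; congr (_ + 'i * _).
have [hw _] := unity_root_ReIm N_gt0 w_N; have [hu _] := unity_root_ReIm N_gt0 (eta1 i).
apply/eqP; rewrite -(@eqrXn2 _ 2) //; apply/eqP.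
by apply: (@addrI _ ('Re u ^+ 2)); rewrite -{1}eq_Re hw hu.
Qed.

Lemma distz_le1 (a b : nat) :
  (a <= b.+1)%N -> (b <= a.+1)%N -> `|a%:Z - b%:Z| <= 1.
Proof. by lia. Qed.

(** The arithmetic of (QP2), where [a], [b], [c], [d] are the heights of [x], [rx], [sx], [srx]: one
    has [c <= a + 1 <= b] and [b <= d + 1 <= c]. *)
Lemma distz_le1_eq (c d a b : nat) :
    `|c%:Z - a%:Z| <= 1 -> `|d%:Z - b%:Z| <= 1 ->
    b%:Z > a%:Z -> d%:Z < c%:Z -> b = c.
Proof. by lia. Qed.

(** * Coxeter length and heights of cosets *)

Section CoxeterLength.

Variables (gT : finGroupType) (S : {set gT}).

Lemma cox_length_le (n : nat) (g : gT) : (g \in S ^+ n)%g -> (cox_length S g <= n)%N.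
Proof.
move=> gSn; rewrite leqNgt; apply/negP=> lt_n.
have n_lt : (n < #|gT|)%N.
  by apply: leq_trans lt_n _; rewrite -[leqRHS](size_iota 0); apply: find_size.
by have := before_find 0%N lt_n; rewrite nth_iota // add0n gSn.
Qed.

Lemma cox_length_ge_card (g : gT) : (cox_length S g <= #|gT|)%N.
Proof. by rewrite -[leqRHS](size_iota 0); apply: find_size. Qed.

Lemma min_length_le (A : {set gT}) (g : gT) :
  g \in A -> (min_length S A <= cox_length S g)%N.
Proof.
move=> gA.
have := @Order.TotalTheory.bigmin_le_cond _ nat _ #|gT| g (mem A) (cox_length S) gA.
by rewrite minEnat leEnat.
Qed.

Lemma min_length_attained (A : {set gT}) (g : gT) :
  g \in A -> exists2 u, u \in A & min_length S A = cox_length S u.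
Proof.
move=> gA; have [u uA umin] := arg_minnP (cox_length S) gA.
exists u => //; apply/eqP; rewrite eqn_leq min_length_le //=.
rewrite /min_length; elim/big_ind: _ => [|a b ha hb|v vA].
- exact: cox_length_ge_card.
- by rewrite leq_min ha.
- exact: umin.
Qed.

Lemma min_length0 (A : {set gT}) : 1%g \in A -> min_length S A = 0%N.
Proof.
move=> A1; apply/eqP; rewrite -leqn0; apply: leq_trans (min_length_le A1) _.
by apply: cox_length_le; rewrite expg0 set11.
Qed.

End CoxeterLength.

(** The rightmost letter is [b], because an [a] at the right end is absorbed into a coset of a
    subgroup that contains [a]. *)
Fixpoint alt_word (gT : finGroupType) (a b : gT) (k : nat) : gT :=
  if k is k'.+1 then ((if odd k' then a else b) * alt_word a b k')%g else 1%g.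

(** * Rotations and reflections in the dihedral group *)

Section DihedralGroup.

Variables (gT : finGroupType) (W : {group gT}) (s t : gT) (m : nat).
Hypothesis m_ge3 : (3 <= m)%N.
Hypothesis genW : <<[set s; t]>>%g = W.
Hypothesis s2 : (s ^+ 2 = 1)%g.
Hypothesis t2 : (t ^+ 2 = 1)%g.
Hypothesis st_m : ((s * t) ^+ m = 1)%g.
Hypothesis cardW : #|W| = (2 * m)%N.

Local Notation r := (s * t)%g.
Local Notation R := <[r]>%g.
Local Notation S := [set s; t].

Lemma sV : (s^-1 = s)%g. Proof. by apply/eqP; rewrite eq_invg_mul -expg2 s2. Qed.
Lemma tV : (t^-1 = t)%g. Proof. by apply/eqP; rewrite eq_invg_mul -expg2 t2. Qed.
Lemma mulss : (s * s = 1)%g. Proof. by rewrite -expg2. Qed.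
Lemma multt : (t * t = 1)%g. Proof. by rewrite -expg2. Qed.

Lemma in_W_s : s \in W. Proof. by rewrite -genW mem_gen ?set21. Qed.
Lemma in_W_t : t \in W. Proof. by rewrite -genW mem_gen ?set22. Qed.
Lemma in_W_r : r \in W. Proof. by rewrite groupM ?in_W_s ?in_W_t. Qed.
Lemma sub_RW : R \subset W. Proof. by rewrite cycle_subG in_W_r. Qed.

Lemma rotV : (r^-1 = t * s)%g. Proof. by rewrite invMg sV tV. Qed.

Lemma rot_conjs x : x \in R -> (x ^ s = x^-1)%g.
Proof.
move=> /cycleP[i ->]; rewrite conjXg -expVgn rotV; congr (_ ^+ i)%g.
by rewrite conjgE sV !mulgA mulss mul1g.
Qed.

Lemma mul_rot_s x : x \in R -> (x * s = s * x^-1)%g.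
Proof. by move=> xR; rewrite -rot_conjs // conjgE sV !mulgA mulss mul1g. Qed.

Lemma norm_s_R : s \in 'N(R).
Proof.
by rewrite -cycle_subG cycle_subG; apply/normP; rewrite -cycleJ rot_conjs ?cycle_id // cycleV.
Qed.

Lemma mul_R_s : (R * <[s]> = W)%g.
Proof.
rewrite -norm_joinEr ?cycle_subG ?norm_s_R //.
apply/eqP; rewrite eqEsubset join_subG !cycle_subG in_W_r in_W_s /= -genW gen_subG.
have sJ : s \in R <*> <[s]> by rewrite mem_gen // inE cycle_id orbT.
apply/subsetP=> x /set2P[] -> //.
have rJ : r \in R <*> <[s]> by rewrite mem_gen // inE cycle_id.
by have := groupM sJ rJ; rewrite mulgA mulss mul1g.
Qed.

Lemma s_neq1 : s != 1%g.
Proof.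
apply/eqP=> s1; have : (#|W| <= 2)%N.
  rewrite -mul_R_s s1 cycle1 mulg1 mul1g -orderE; apply: dvdn_leq => //.
  by rewrite order_dvdn t2.
by rewrite cardW; lia.
Qed.

Lemma order_s : #[s] = 2%N.
Proof. by apply: nt_prime_order; rewrite ?s_neq1. Qed.

(** [W] is the product of [R] and [<[s]>], so a smaller order of [r] would make [#|W|] less than
    [2 * m]. *)
Lemma order_r : #[r] = m.
Proof.
have le_m : (#[r] <= m)%N by apply: dvdn_leq; [lia | rewrite order_dvdn st_m].
apply/eqP; rewrite eqn_leq le_m /=.
have : (#|W| <= #[r] * #[s])%N.
  by rewrite [leqRHS]mul_cardG mul_R_s leq_pmulr ?cardG_gt0.
by rewrite cardW order_s; lia.
Qed.

Lemma cardR : #|R| = m. Proof. by rewrite -orderE order_r. Qed.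

Lemma notR_s : s \notin R.
Proof.
apply/negP=> sR; have := cardW; rewrite -mul_R_s mulGSid ?cycle_subG // cardR; lia.
Qed.

Lemma sdprod_R_s : (R ><| <[s]> = W)%g.
Proof.
rewrite sdprodE ?mul_R_s ?cycle_subG ?norm_s_R //.
by rewrite setIC prime_TIg ?cycle_subG ?notR_s // -orderE order_s.
Qed.

Lemma dihedral_split g : g \in W -> (g \in R) || ((g * s)%g \in R).
Proof.
rewrite -mul_R_s => /mulsgP[x y xR].
rewrite cycle2g ?order_s // => /set2P[] -> ->; first by rewrite mulg1 xR.
by rewrite -mulgA mulss mulg1 xR orbT.
Qed.

Lemma reflE g : g \in W -> g \notin R -> exists2 x, x \in R & g = (x * s)%g.
Proof.
move=> /dihedral_split/orP[->//|gsR] _; exists (g * s)%g => //.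
by rewrite -mulgA mulss mulg1.
Qed.

(** The product of two reflections [x * s] and [y * s] is the rotation [x * y^-1]; the other cases
    hold in any group. *)
Lemma mem_rotM g h : g \in W -> h \in W -> ((g * h)%g \in R) = ((g \in R) == (h \in R)).
Proof.
move=> gW hW; have [gR|gR] := boolP (g \in R); first by rewrite groupMl //; case: (h \in R).
have [hR|hR] := boolP (h \in R); first by rewrite groupMr // (negPf gR).
have [x xR ->] := reflE gW gR; have [y yR ->] := reflE hW hR.
by rewrite mulgA -[(x * s * y)%g]mulgA -{1}[y]invgK -mul_rot_s ?groupV //
  !mulgA -mulgA mulss mulg1 groupM ?groupV.
Qed.

Lemma notR_t : t \notin R.
Proof.
apply/negP=> tR; have := mem_rotM in_W_s in_W_t.
by rewrite cycle_id tR (negPf notR_s).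
Qed.

Lemma refl_conj x g : x \in R -> g \in W -> g \notin R -> (x ^ g = x^-1)%g.
Proof.
move=> xR gW /(reflE gW)[y yR ->]; rewrite conjgM.
by rewrite [(x ^ y)%g]conjgE (centsP (cycle_abelian r) _ xR _ yR) mulKg rot_conjs.
Qed.

Lemma refl_invol g : g \in W -> g \notin R -> (g * g = 1)%g.
Proof.
move=> gW /(reflE gW)[y yR ->].
by rewrite mulgA -[(y * s * y)%g]mulgA -{2}[y]invgK -mul_rot_s ?groupV // !mulgA mulgV
  mul1g mulss.
Qed.

(** A reflection [r ^+ i * s] is the conjugate of [s] by [r ^+ i./2] if [i] is even, and the
    conjugate of [t] by [r ^+ i./2 * s] if [i] is odd. *)
Lemma sub_notR_refls g : g \in W -> g \notin R -> g \in refls S.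
Proof.
move=> gW /(reflE gW)[x /cycleP[i ->] ->{g gW}].
have conj_rot (k : nat) (y : gT) : y \in W -> y \notin R ->
    (r ^+ k * y * (r ^+ k)^-1 = r ^+ k.*2 * y)%g.
  move=> yW yR; rewrite -addnn expgD -!mulgA; congr (_ * _)%g.
  rewrite -(refl_conj _ yW yR) ?groupX ?cycle_id //.
  by rewrite conjgE !mulgA mulgV mul1g.
apply/imset2P; rewrite genW; have [i2|i2] := boolP (odd i); last first.
  exists (r ^+ i./2)%g s; rewrite ?set21 ?groupX ?in_W_r //.
  by rewrite conj_rot ?in_W_s ?notR_s // even_halfK.
exists (r ^+ i./2 * s)%g t; rewrite ?set22 ?groupM ?groupX ?in_W_r ?in_W_s //.
have rsW : (r * s)%g \in W by rewrite groupM ?in_W_r ?in_W_s.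
have rsR : (r * s)%g \notin R by rewrite groupMl ?cycle_id ?notR_s.
rewrite -[in LHS](odd_double_half i) i2 add1n expgSr -mulgA -conj_rot //.
by rewrite invMg sV !mulgA.
Qed.

Lemma letterW x : x \in S -> x \in W.
Proof. by case/set2P=> ->; rewrite ?in_W_s ?in_W_t. Qed.

Lemma letter_mul x : x \in S -> (x * x = 1)%g.
Proof. by case/set2P=> ->; rewrite ?mulss ?multt. Qed.

Lemma letter_notR x : x \in S -> x \notin R.
Proof. by case/set2P=> ->; rewrite ?notR_s ?notR_t. Qed.

Lemma refl_order u : u \in S -> #[u] = 2%N.
Proof.
move=> uS; apply: nt_prime_order => //; first by rewrite expg2 letter_mul.
by apply: contraNneq (letter_notR uS) => ->; rewrite group1.
Qed.

(** This makes the bounded search in [cox_length] succeed: a rotation needs at most [2 * m - 2]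
    letters and a reflection at most one more. *)
Lemma mem_word_short g : g \in W -> exists2 n, (n < #|gT|)%N & g \in (S ^+ n)%g.
Proof.
have rS k : (r ^+ k)%g \in (S ^+ (2 * k))%g.
  rewrite expgM; elim: k => [|k IHk]; first by rewrite !expg0 set11.
  by rewrite (expgSr r) (expgSr (S ^+ 2)%g) mem_mulg // expg2 mem_mulg ?set21 ?set22.
have le_gT : (2 * m <= #|gT|)%N by rewrite -cardW max_card.
move=> gW; have [gR|gR] := boolP (g \in R).
  have [i lt_i ->] := cyclePmin gR; exists (2 * i)%N => //.
  by rewrite order_r in lt_i; lia.
have [x xR ->] := reflE gW gR; have [i lt_i ->] := cyclePmin xR.
exists (2 * i).+1; first by rewrite order_r in lt_i; lia.
by rewrite expgSr mem_mulg ?set21.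
Qed.

Lemma mem_cox_length g : g \in W -> g \in (S ^+ cox_length S g)%g.
Proof.
move=> /mem_word_short[n lt_n gSn].
have hasg : has (fun n => g \in (S ^+ n)%g) (iota 0 #|gT|).
  by apply/hasP; exists n => //; rewrite mem_iota.
have := nth_find 0%N hasg; rewrite nth_iota //.
by rewrite has_find size_iota in hasg.
Qed.

Lemma cox_lengthM x g : x \in S -> g \in W ->
  (cox_length S (x * g) <= (cox_length S g).+1)%N.
Proof. by move=> xS gW; rewrite cox_length_le // expgS mem_mulg ?mem_cox_length. Qed.

(** * Quasiparabolic subgroups and the heights of their cosets *)

Section Cosets.

Variable H : {group gT}.
Hypothesis sHW : H \subset W.

Lemma coset_subW C : C \in lcosets H W -> C \subset W.
Proof. by case/lcosetsP=> x xW ->; apply: mul_subG; rewrite ?sub1set. Qed.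

Lemma coset_eq C x : C \in lcosets H W -> x \in C -> C = (x *: H)%g.
Proof. by case/lcosetsP=> y yW -> xC; rewrite (lcoset_eqP xC). Qed.

Lemma mem_lcosets x C : x \in W -> C \in lcosets H W -> (x *: C)%g \in lcosets H W.
Proof.
move=> xW /lcosetsP[y yW ->]; apply/lcosetsP; exists (x * y)%g; first by rewrite groupM.
by rewrite lcosetM.
Qed.

Lemma coset_neq0 C : C \in lcosets H W -> exists g, g \in C.
Proof. by case/lcosetsP=> x _ ->; exists x; apply: lcoset_refl. Qed.

Lemma min_length_mem C : C \in lcosets H W ->
  exists2 g, g \in C & g \in (S ^+ min_length S C)%g.
Proof.
move=> CL; have [g0 gC0] := coset_neq0 CL.
have [g gC ->] := min_length_attained S gC0; exists g => //.
by rewrite mem_cox_length // (subsetP (coset_subW CL)).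
Qed.

Lemma min_length_eq0 C : C \in lcosets H W -> min_length S C = 0%N -> C = H.
Proof.
move=> CL C0; have [g gC] := min_length_mem CL.
by rewrite C0 expg0 => /set1P g1; rewrite (coset_eq CL gC) g1 mul1g.
Qed.

Lemma min_length_letter x C : x \in S -> C \in lcosets H W ->
  (min_length S (x *: C)%g <= (min_length S C).+1)%N.
Proof.
move=> xS CL; have [g0 gC0] := coset_neq0 CL.
have [g gC ->] := min_length_attained S gC0.
apply: leq_trans (cox_lengthM xS (subsetP (coset_subW CL) g gC)).
by apply: min_length_le; rewrite mem_lcoset mulKg.
Qed.

Lemma scaled_cosets :
  scaled_set S (mem (lcosets H W)) (fun w (C : {set gT}) => w *: C)%g
    (fun C => (min_length S C)%:Z).
Proof.
split=> [w C||v w C _ _ _|x C xS CL].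
- by rewrite genW => wW CL; apply: mem_lcosets.
- by move=> C _; rewrite mul1g.
- by rewrite lcosetM.
have le1 := min_length_letter xS CL.
have := min_length_letter xS (mem_lcosets (letterW xS) CL).
by rewrite -lcosetM letter_mul // mul1g => le2; apply: distz_le1.
Qed.

(** (QP1) is immediate. In (QP2) the heights change by at most 1 under a letter, which forces the
    two cosets in the conclusion to have equal height. *)
Lemma qp_of_injective_height :
    {in lcosets H W &, injective (min_length S)} -> qp_subgroup S H.
Proof.
move=> inj_h; split; first by rewrite genW.
rewrite genW; have [h1 h2 h3 h4] := scaled_cosets.
have reflW x : x \in refls S -> x \in W.
  case/imset2P=> w y; rewrite genW => wW yS ->.
  by rewrite !groupM ?groupV ?(letterW yS).
split=> // [C x CL xT [hC]|C x y CL xT yS hxC hyxC].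
  by apply: inj_h => //; apply: mem_lcosets => //; apply: reflW.
have xCL := mem_lcosets (reflW _ xT) CL; have yCL := mem_lcosets (letterW yS) CL.
apply: inj_h => //.
exact: distz_le1_eq (h4 y C yS CL) (h4 y (x *: C)%g yS xCL) hxC hyxC.
Qed.

Section AltWords.

Variables a b : gT.
Hypothesis defS : [set a; b] = S.

Lemma word_lcoset n g : a \in H -> g \in (S ^+ n)%g ->
  exists2 k, (k <= n)%N & (g *: H = alt_word a b k *: H)%g.
Proof.
move=> aH; elim: n g => [|n IHn] g.
  by rewrite expg0 => /set1P->; exists 0%N.
rewrite expgS => /mulsgP[x g' xS /IHn[k le_k eqH] ->].
rewrite lcosetM eqH -lcosetM; have := xS; rewrite -defS => /set2P xab.
case: k => [|k] in le_k eqH *.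
  rewrite mulg1; case: xab => ->; last by exists 1%N; rewrite //= mulg1.
  by exists 0%N; rewrite //= lcoset_id // mul1g.
(* The new letter either cancels the leading letter of the alternating word or, being the other one
   of the two letters, prolongs the alternation. *)
have [def_x|nx] := eqVneq x (if odd k then a else b).
  by exists k; [lia | rewrite /= -def_x mulgA letter_mul ?mul1g].
exists k.+2 => //=; congr ((_ * _) *: _)%g.
by case: xab nx => ->; case: (odd k); rewrite /= ?eqxx.
Qed.

Lemma alt_word_mem k : alt_word a b k \in (S ^+ k)%g.
Proof.
elim: k => [|k IHk]; first by rewrite expg0 set11.
by rewrite expgS mem_mulg // -defS; case: ifP; rewrite ?set21 ?set22.
Qed.

(* A coset of minimal length [n] contains the alternating word of [n] letters
   ending in [b]. *)
Lemma qp_of_mem_letter : a \in H -> qp_subgroup S H.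
Proof.
move=> aH; apply: qp_of_injective_height.
have heightP C : C \in lcosets H W -> C = (alt_word a b (min_length S C) *: H)%g.
  move=> CL; have [g gC gS] := min_length_mem CL.
  have [k le_k] := word_lcoset aH gS; rewrite -(coset_eq CL gC) => defC.
  suff -> : min_length S C = k by [].
  apply/eqP; rewrite eqn_leq le_k andbT.
  apply: leq_trans (cox_length_le (alt_word_mem k)); apply: min_length_le.
  by rewrite defC lcoset_refl.
by move=> C D CL DL eqh; rewrite (heightP C CL) (heightP D DL) eqh.
Qed.

End AltWords.

Lemma qp_of_mem_gen : s \in H \/ t \in H -> qp_subgroup S H.
Proof. by case; apply: qp_of_mem_letter; first [exact: erefl | exact: setUC]. Qed.

(** Only the coset [H] itself has height 0, so the two cosets have distinct heights. *)
Lemma qp_of_index2 : #|W : H| = 2%N -> qp_subgroup S H.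
Proof.
move=> iH; apply: qp_of_injective_height => C D CL DL eqh.
have HL : (H : {set gT}) \in lcosets H W.
  by apply/lcosetsP; exists 1%g; rewrite ?group1 ?mul1g.
have [CH|CH] := eqVneq C (H : {set gT}).
  by rewrite CH (min_length_eq0 DL) // -eqh CH min_length0.
have [DH|DH] := eqVneq D (H : {set gT}).
  by rewrite DH (min_length_eq0 CL) // eqh DH min_length0.
have [//|neq] := eqVneq C D.
have : (#|[set (H : {set gT}); C; D]| <= #|lcosets H W|)%N.
  by apply: subset_leq_card; apply/subsetP=> E; rewrite !inE => /orP[/orP[]|] /eqP->.
by rewrite card_lcosets iH setUC cardsU1 cards2 !inE (negPf DH) eq_sym (negPf neq) eq_sym CH.
Qed.

(* If neither [s] nor [t] is in [H], then [s *: H] and [t *: H] both have height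
   1 and a reflection carries one onto the other, so (QP1) identifies them. *)
Lemma qp_contains_letter : qp_subgroup S H -> ~~ (H \subset R) -> s \in H \/ t \in H.
Proof.
case=> _ [_ qp1 _] /subsetPn[y yH yR].
have [sH|sH] := boolP (s \in H); first by left.
have [tH|tH] := boolP (t \in H); first by right.
have yW := subsetP sHW y yH.
rewrite genW in qp1.
have HL : (H : {set gT}) \in lcosets H W.
  by apply/lcosetsP; exists 1%g; rewrite ?group1 ?mul1g.
have height1 x : x \in S -> x \notin H -> min_length S (x *: H)%g = 1%N.
  move=> xS xH; apply/eqP; rewrite eqn_leq; apply/andP; split.
    apply: leq_trans (min_length_letter xS HL) _.
    by rewrite min_length0 ?group1.
  rewrite lt0n; apply: contra xH => /eqP x0.
  have <- := min_length_eq0 (mem_lcosets (letterW xS) HL) x0.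
  exact: lcoset_refl.
have hs := height1 s (set21 _ _) sH; have ht := height1 t (set22 _ _) tH.
(* With [y] a reflection in [H], the product [t * y * s] of three reflections is a reflection, and
   it carries [s *: H] onto [t *: H]. *)
have xW : (t * y * s)%g \in W by rewrite !groupM ?in_W_t ?in_W_s.
have def_x : ((t * y * s) *: (s *: H) = t *: H)%g.
  by rewrite -lcosetM -!mulgA mulss mulg1 lcosetM lcoset_id.
have eq_st : (t *: H = s *: H)%g.
  rewrite -def_x; apply: qp1.
  - by apply: mem_lcosets; rewrite ?in_W_s.
  - apply: sub_notR_refls => //.
    by rewrite !mem_rotM ?groupM ?in_W_t ?in_W_s // (negPf notR_s) (negPf notR_t) (negPf yR).
  - by rewrite /= def_x hs ht.
(* Equality of the two cosets puts [r], hence all of [R], into [H]; together with the reflection [y]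
   this puts [s] into [H], a contradiction. *)
have rH : r \in H.
  have : t \in (s *: H)%g by rewrite -eq_st lcoset_refl.
  by rewrite mem_lcoset sV.
have [z zR def_y] := reflE yW yR.
by case/negP: sH; rewrite -(groupMl _ (subsetP (_ : R \subset H) z zR)) ?cycle_subG // -def_y.
Qed.

End Cosets.

(** * Characters of the dihedral group *)

Lemma normal_RW : R <| W.
Proof. by have [] := sdprod_context sdprod_R_s. Qed.

Lemma index_R : #|W : R| = 2%N.
Proof. by rewrite -divgS ?sub_RW // cardR cardW mulnK //; lia. Qed.

Lemma Ind_rotE (xi : 'CF(R)) x : 'Ind[W, R] xi x = xi x + xi (x ^ s)%g.
Proof.
rewrite (cfIndEsdprod _ _ sdprod_R_s) (eq_bigl [in [set 1%g; s]]) => [|w]; last first.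
  by rewrite /= cycle2g ?order_s.
by rewrite big_setU1 ?inE 1?eq_sym ?s_neq1 // big_set1 conjg1.
Qed.

Lemma Ind_rot0 (xi : 'CF(R)) x : x \notin R -> 'Ind[W, R] xi x = 0.
Proof. by move=> xR; apply: cfun_on0 (cfInd_normal xi normal_RW) xR. Qed.

Lemma Ind_rot1 (xi : 'CF(R)) : xi \is a linear_char -> 'Ind[W, R] xi 1%g = 2.
Proof. by move=> Lxi; rewrite cfInd1 ?sub_RW // index_R lin_char1 // mulr1. Qed.

(** [W] is generated by the involutions [s] and [t], so all values of a linear character are
    signs. *)
Lemma lin_sqr (lam : 'CF(W)) x : lam \is a linear_char -> x \in W -> lam x ^+ 2 = 1.
Proof.
move=> Llam xW; have sqr1 g : g \in W -> (g * g = 1)%g -> lam g ^+ 2 = 1.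
  by move=> gW gg; rewrite -lin_charX // expgS expg1 gg lin_char1.
have [/cycleP[i ->]|xR] := boolP (x \in R); last by apply: sqr1 => //; apply: refl_invol.
rewrite lin_charX ?in_W_r // exprAC lin_charM ?in_W_s ?in_W_t //.
by rewrite [(_ * _) ^+ 2]exprMn !sqr1 ?in_W_s ?in_W_t ?mulss ?multt // mulr1 expr1n.
Qed.

Lemma lin_pm1 (lam : 'CF(W)) x :
  lam \is a linear_char -> x \in W -> exists b : bool, lam x = (-1) ^+ b.
Proof.
move=> Llam xW; have /eqP := lin_sqr Llam xW; rewrite sqrf_eq1 => /orP[]/eqP->.
  by exists false.
by exists true.
Qed.

Lemma lin_conj (lam : 'CF(W)) x : lam \is a linear_char -> x \in W -> (lam x)^* = lam x.
Proof. by move=> Llam xW; have [b ->] := lin_pm1 Llam xW; rewrite rmorph_sign. Qed.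

Lemma lin_inv (lam : 'CF(W)) x : lam \is a linear_char -> x \in W -> lam x^-1%g = lam x.
Proof. by move=> Llam xW; rewrite lin_charV_conj // lin_conj. Qed.

Lemma lin_eq (lam mu : 'CF(W)) : lam \is a linear_char -> mu \is a linear_char ->
  lam s = mu s -> lam t = mu t -> lam = mu.
Proof.
move=> Llam Lmu eq_s eq_t; have eq_r : lam r = mu r.
  by rewrite !lin_charM ?in_W_s ?in_W_t // eq_s eq_t.
have eqR x : x \in R -> lam x = mu x.
  by move=> /cycleP[i ->]; rewrite !lin_charX ?in_W_r // eq_r.
apply/cfun_inP=> x xW; have [/eqR//|/(reflE xW)[y yR ->]] := boolP (x \in R).
by rewrite !lin_charM ?in_W_s ?(subsetP sub_RW) // eqR // eq_s.
Qed.

Lemma irr_deg_nonlin (k : Iirr W) : 'chi_k \isn't a linear_char -> 2 <= 'chi_k 1%g.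
Proof.
rewrite qualifE /= irr_char /= => /negPf k1; have /natrP[d def_d] := Cnat_irr1 k.
have := irr1_gt0 k; move: k1; rewrite def_d pnatr_eq1 ltr0n ler_nat.
by case: d {def_d} => [|[|d]].
Qed.

(** The induced character has degree 2 and the constituent has degree at least 2, so nothing is left
    beside it. *)
Lemma constt_Ind_nonlin (k : Iirr W) (l : Iirr R) : 'chi_k \isn't a linear_char ->
  k \in irr_constt ('Ind[W, R] 'chi_l) -> 'chi_k = 'Ind[W, R] 'chi_l.
Proof.
move=> k_nonlin; have Ll : 'chi_l \is a linear_char by apply: irr_cyclic_lin (cycle_cyclic r).
case/constt_charP=> [|chi' Nchi' defI]; first by rewrite cfInd_char ?irr_char.
suff chi'0 : chi' = 0 by rewrite defI chi'0 addr0.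
apply/eqP; rewrite -char1_eq0 // eq_le char1_ge0 // andbT.
have := Ind_rot1 Ll; rewrite defI cfunE => def2.
by rewrite -(lerD2l ('chi_k 1%g)) def2 addr0 irr_deg_nonlin.
Qed.

Lemma nonlin_Ind (k : Iirr W) : 'chi_k \isn't a linear_char ->
  exists l : Iirr R, 'chi_k = 'Ind[W, R] 'chi_l.
Proof.
have [l kl] := constt_cfRes_irr <[r]>%G k; exists l.
by apply: constt_Ind_nonlin => //; rewrite constt_Ind_Res.
Qed.

Lemma irr_deg2 (k : Iirr W) : 'chi_k \isn't a linear_char -> 'chi_k 1%g = 2.
Proof.
move=> /nonlin_Ind[l ->]; apply: Ind_rot1; exact: irr_cyclic_lin (cycle_cyclic r).
Qed.

(** A linear constituent would restrict to ['chi_l] on [R], but linear characters of [W] take only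
    sign values at [r]. *)
Lemma Ind_rot_irr (l : Iirr R) : 'chi_l r ^+ 2 != 1 ->
  exists2 k : Iirr W, 'chi_k \isn't a linear_char & 'chi_k = 'Ind[W, R] 'chi_l.
Proof.
move=> l2; have [k kl] := constt_cfInd_irr l sub_RW.
suff k_nonlin : 'chi_k \isn't a linear_char by exists k => //; apply: constt_Ind_nonlin.
apply: contra l2 => Lk; move: kl; rewrite constt_Ind_Res.
have LRk : 'Res[R] 'chi_k \is a linear_char by apply: cfRes_lin_char.
have /irrP[j def_j] := lin_char_irr LRk; rewrite def_j constt_irr => /eqP->.
by rewrite -def_j cfResE ?sub_RW ?cycle_id // lin_sqr ?in_W_r.
Qed.

Lemma card_notsubR (H : {group gT}) : H \subset W -> ~~ (H \subset R) ->
  #|H| = (2 * #|H :&: R|)%N.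
Proof.
move=> sHW /subsetPn[y yH yR].
have HR : (H * R = W)%g.
  apply/eqP; rewrite eqEsubset mul_subG ?sub_RW //=; apply/subsetP=> g gW.
  have yW := subsetP sHW y yH.
  have [gR|gR] := boolP (g \in R); first by rewrite -[g]mul1g mem_mulg.
  by rewrite -[g](mulKVg y) mem_mulg // mem_rotM ?groupV // (negPf gR) (negPf yR).
have := mul_cardG H <[r]>; rewrite HR cardW cardR /= => eqc.
by apply/eqP; rewrite -(@eqn_pmul2r m); [apply/eqP; rewrite eqc; lia | lia].
Qed.

Lemma lin_cfdot (K : {group gT}) (phi psi : 'CF(K)) :
  phi \is a linear_char -> psi \is a linear_char -> '[phi, psi] = (phi == psi)%:R.
Proof.
move=> /lin_char_irr/irrP[i ->] /lin_char_irr/irrP[j ->].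
by rewrite cfdot_irr (inj_eq irr_inj).
Qed.

Lemma mult_lin (H : {group gT}) (lam mu : 'CF(W)) : H \subset W ->
    lam \is a linear_char -> mu \is a linear_char ->
  '['Ind[W, H] ('Res[H] lam), mu] = [forall x in H, lam x == mu x]%:R.
Proof.
move=> sHW Llam Lmu; rewrite -Frobenius_reciprocity lin_cfdot ?cfRes_lin_char //.
congr (nat_of_bool _)%:R; apply/eqP/forall_inP => [eqR x xH | eqH].
  by apply/eqP; have := congr1 (fun f : 'CF(H) => f x) eqR; rewrite /= !cfResE.
by apply/cfun_inP=> x xH; rewrite !cfResE //; apply/eqP/eqH.
Qed.

(** ['Ind[W, R] xi] vanishes off [R] and is [xi x + xi x^-1] on it, so the inner product over [H] is
    twice a sum over [H :&: R], which orthogonality evaluates. The factor 2 disappears when [H]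
    contains a reflection, since then [H] has twice the order of [H :&: R]. *)
Lemma mult_nonlin (H : {group gT}) (lam : 'CF(W)) (xi : 'CF(R)) : H \subset W ->
    lam \is a linear_char -> xi \is a linear_char ->
  '['Ind[W, H] ('Res[H] lam), 'Ind[W, R] xi] =
    (if H \subset R then 2 else 1) * [forall x in H :&: R, lam x == xi x]%:R.
Proof.
move=> sHW Llam Lxi; rewrite -Frobenius_reciprocity cfdotE.
have sKR : H :&: R \subset R by apply: subsetIr.
have sKW : H :&: R \subset W by apply: subset_trans sKR sub_RW.
pose D := \sum_(x in H :&: R) lam x * (xi x)^*.
have -> : \sum_(x in H) 'Res[H] lam x * ('Res[H] ('Ind[W, R] xi) x)^* = 2 * D.
  rewrite (big_setID R) /= addrC big1 ?add0r => [|x]; last first.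
    by rewrite inE => /andP[xR xH]; rewrite !cfResE // Ind_rot0 // conjC0 mulr0.
  rewrite mulrDl mul1r.
  (* Since [lam x^-1 = lam x], substituting [x^-1] for [x] turns the second half of the sum into the
     first. *)
  rewrite (eq_bigr (fun x => lam x * (xi x)^* + lam x^-1%g * (xi x^-1%g)^*)) => [|x].
    rewrite big_split /=; congr (_ + _); rewrite (reindex_inj invg_inj) /=.
    by apply: eq_big => [x | x _]; rewrite ?groupV ?invgK.
  move=> /setIP[xH xR]; have xW := subsetP sHW x xH.
  by rewrite !cfResE // Ind_rotE rot_conjs // lin_inv // rmorphD mulrDr.
have -> : D = #|H :&: R|%:R * [forall x in H :&: R, lam x == xi x]%:R.
  have := @lin_cfdot (H :&: R)%G ('Res lam) ('Res xi).
  rewrite cfdotE !cfRes_lin_char // => /(_ isT isT) /(canRL (mulKf _)) defD.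
  rewrite /D (eq_bigr (fun x => 'Res[H :&: R] lam x * ('Res[H :&: R] xi x)^*)).
    rewrite defD ?invr_eq0 ?neq0CG // invrK; congr (_ * (nat_of_bool _)%:R).
    apply/eqP/forall_inP => [eqR x xK | eqK].
      by apply/eqP; have := congr1 (fun f : 'CF(H :&: R) => f x) eqR; rewrite /= !cfResE.
    by apply/cfun_inP=> x xK; rewrite !cfResE //; apply/eqP/eqK.
  by move=> x xK; rewrite !cfResE.
have [sHR | nHR] := boolP (H \subset R).
  by rewrite (setIidPl sHR) [2 * _]mulrCA mulKf // neq0CG.
rewrite (card_notsubR sHW nHR) natrM /= mul1r mulrA mulKf //.
by rewrite mulf_neq0 ?pnatr_eq0 -?lt0n ?cardG_gt0.
Qed.

(** * Linear characters and their signs on [s] and [t] *)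

Definition lin_irr : {set Iirr W} := [set i | 'chi_i \is a linear_char].

(** Two rotations commute. A commutator involving a reflection is the square of a rotation: of the
    rotation or its inverse in the mixed case, of the product for two reflections. *)
Lemma der1_sub_rot2 : (W^`(1) \subset <[r ^+ 2]>)%g.
Proof.
rewrite derg1 gen_subG; apply/subsetP=> _ /imset2P[x y xW yW ->].
have sqr_rot z : z \in R -> (z * z)%g \in <[r ^+ 2]>%g.
  by move=> /cycleP[i ->]; rewrite -expgD addnn -mul2n expgM mem_cycle.
have [xR|xR] := boolP (x \in R); have [yR|yR] := boolP (y \in R).
- suff /eqP-> : [~ x, y] == 1%g by rewrite group1.
  by apply/commgP; apply: (centsP (cycle_abelian r)).
- by rewrite commgEl (refl_conj xR yW yR) sqr_rot ?groupV.
- by rewrite commgEr (refl_conj _ xW xR) ?groupV // invgK sqr_rot.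
have reflV g : g \in W -> g \notin R -> (g^-1 = g)%g.
  by move=> gW gR; apply/eqP; rewrite eq_invg_mul refl_invol.
rewrite commgEl conjgE !reflV // mulgA; apply: sqr_rot.
by rewrite mem_rotM // (negPf xR) (negPf yR).
Qed.

Lemma lin_odd (lam : 'CF(W)) : odd m -> lam \is a linear_char -> lam s = lam t.
Proof.
move=> m_odd Llam; have [a sa] := lin_pm1 Llam in_W_s; have [b tb] := lin_pm1 Llam in_W_t.
have : lam r ^+ m = 1 by rewrite -lin_charX ?in_W_r // st_m lin_char1.
rewrite lin_charM ?in_W_s ?in_W_t // sa tb -signr_addb -exprM.
rewrite -[(-1) ^+ (_ * _)]signr_odd oddM oddb m_odd andbT.
by case: a b {sa tb} => [] [] //= /eqP;
  rewrite expr1 -subr_eq0 -opprD oppr_eq0 (pnatr_eq0 _ 2).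
Qed.

(** The boolean [true] encodes the value [-1], so that the values are [(-1) ^+ b]. *)
Definition lin_sign (i : Iirr W) : bool * bool := ('chi_i s == -1, 'chi_i t == -1).

Lemma signr_eqN1 (b : bool) : ((-1) ^+ b == -1 :> algC) = b.
Proof. by case: b; rewrite ?expr1 ?eqxx // expr0 -addr_eq0 (pnatr_eq0 _ 2). Qed.

Lemma lin_signE (i : Iirr W) : i \in lin_irr ->
  'chi_i s = (-1) ^+ (lin_sign i).1 /\ 'chi_i t = (-1) ^+ (lin_sign i).2.
Proof.
rewrite inE => Li; rewrite /lin_sign /=.
have [a ->] := lin_pm1 Li in_W_s; have [b ->] := lin_pm1 Li in_W_t.
by rewrite !signr_eqN1.
Qed.

Lemma lin_sign_inj : {in lin_irr &, injective lin_sign}.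
Proof.
move=> i j Li Lj eqij; apply: irr_inj.
have [is_ it_] := lin_signE Li; have [js jt] := lin_signE Lj.
by move: Li Lj; rewrite !inE => Li Lj; apply: lin_eq => //; rewrite ?is_ ?it_ ?js ?jt eqij.
Qed.

(** The number of linear characters is the index of the commutator subgroup, which lies in
    [<[r ^+ 2]>]. *)
Lemma card_lin_irr_ge : (2 * gcdn m 2 <= #|lin_irr|)%N.
Proof.
have -> : #|lin_irr| = #|W : W^`(1)%g|.
  by rewrite -card_lin_irr; apply: eq_card => i; rewrite !inE.
have sr2W : <[r ^+ 2]>%g \subset W by rewrite cycle_subG groupX ?in_W_r.
have <- : #|W : <[r ^+ 2]>%g| = (2 * gcdn m 2)%N.
  rewrite -divgS // cardW -orderE orderXgcd order_r.
  have := dvdn_gcdl m 2; move: (gcdn m 2) (gcdn_gt0 m 2) => d.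
  rewrite orbT => d_gt0 /dvdnP[k def_m]; rewrite def_m mulnK //.
  by rewrite [(k * d)%N]mulnC mulnA mulnK //; lia.
by apply: dvdn_leq; rewrite ?indexg_gt0 // indexgS // der1_sub_rot2.
Qed.

Definition sign_set : {set bool * bool} := [set ab | ~~ odd m || (ab.1 == ab.2)].

Lemma gcdm2 : gcdn m 2 = if odd m then 1%N else 2.
Proof. by rewrite gcdnC; have := gcdn_modr 2 m; rewrite modn2 => <-; case: (odd m). Qed.

Lemma card_sign_set : #|sign_set| = (2 * gcdn m 2)%N.
Proof.
rewrite gcdm2 /sign_set; case: (odd m) => /=.
  have -> : [set ab : bool * bool | ab.1 == ab.2] = [set (true, true); (false, false)].
    by apply/setP=> -[[] []]; rewrite !inE.
  by rewrite cards2.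
have -> : [set _ : bool * bool | true] = setT by apply/setP=> ab; rewrite !inE.
by rewrite cardsT card_prod !card_bool.
Qed.

(** [lin_sign] maps injectively into the admissible pairs of signs, and the lower bound on the
    number of linear characters makes it onto. *)
Lemma lin_sign_image : [set lin_sign i | i in lin_irr] = sign_set.
Proof.
apply/eqP; rewrite eqEcard card_sign_set card_in_imset ?card_lin_irr_ge ?andbT; last first.
  exact: lin_sign_inj.
apply/subsetP=> _ /imsetP[i Li ->]; rewrite inE -implybE; apply/implyP=> m_odd.
have [is_ it_] := lin_signE Li; move: Li; rewrite inE => Li.
by have := lin_odd m_odd Li; rewrite is_ it_ => /eqP; rewrite (inj_eq signr_inj).
Qed.

Lemma lin_exists (a b : bool) : ~~ odd m || (a == b) ->
  exists2 i, i \in lin_irr & 'chi_i s = (-1) ^+ a /\ 'chi_i t = (-1) ^+ b.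
Proof.
move=> ab; have : (a, b) \in sign_set by rewrite inE.
rewrite -lin_sign_image => /imsetP[i Li [-> ->]]; exists i => //.
exact: lin_signE Li.
Qed.

Lemma card_lin : #|lin_irr| = (2 * gcdn m 2)%N.
Proof. by rewrite -card_sign_set -lin_sign_image card_in_imset //; apply: lin_sign_inj. Qed.

(** * Two-dimensional irreducible characters *)

Definition zeta : algC := m.-root (-1) ^+ 2.

Lemma prim_zeta : m.-primitive_root zeta.
Proof.
have m_gt1 : (1 < m)%N by lia.
have := exp_prim_root (prim_rootCN1 m_gt1) 2.
by rewrite gcdnMr mulKn.
Qed.

(** The values at [r] are [m]-th roots of unity and determine the character of [R]. There are [m]
    such characters, so every [m]-th root of unity occurs. *)
Lemma rot_char_exists (k : nat) : exists l : Iirr R, 'chi_l r = zeta ^+ k.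
Proof.
have Ll (l : Iirr R) : 'chi_l \is a linear_char by apply: irr_cyclic_lin (cycle_cyclic r).
have root_l (l : Iirr R) : 'chi_l r ^+ m = 1.
  by rewrite -lin_charX ?cycle_id // st_m lin_char1.
pose f (l : Iirr R) := sval (prim_rootP prim_zeta (root_l l)).
have fE l : 'chi_l r = zeta ^+ f l by rewrite /f; case: (prim_rootP _ _).
have f_inj : injective f.
  move=> l1 l2 eqf; apply/irr_inj/cfun_inP=> _ /cycleP[i ->].
  by rewrite !lin_charX ?cycle_id // !fE eqf.
have le_card : (#|'I_m| <= #|Iirr R|)%N.
  by rewrite card_Iirr_cyclic ?cycle_cyclic // cardR card_ord.
have lt_k : (k %% m < m)%N by rewrite ltn_mod; lia.
have /codomP[l def_k] := inj_card_onto f_inj le_card (Ordinal lt_k).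
by exists l; rewrite fE -def_k /= (prim_expr_mod prim_zeta).
Qed.

(** The bounds on [h] give [zeta ^+ (2 * h) != 1], which makes the induced character irreducible;
    its value at [r ^+ j] is [zeta ^+ (h * j)] plus the conjugate. *)
Lemma rho_exists (h : nat) : (0 < h)%N -> (2 * h < m)%N ->
  exists (k : Iirr W) (l : Iirr R), [/\ 'chi_k \isn't a linear_char,
    'chi_k = 'Ind[W, R] 'chi_l, 'chi_l r = zeta ^+ h & is_rho m s t h k].
Proof.
move=> h_gt0 lt_h; have [l lr] := rot_char_exists h.
have Ll : 'chi_l \is a linear_char by apply: irr_cyclic_lin (cycle_cyclic r).
have [|k k_nonlin def_k] := @Ind_rot_irr l.
  rewrite lr -exprM -(prim_order_dvd prim_zeta); apply/negP=> /dvdn_leq.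
  by rewrite muln_gt0 h_gt0 => /(_ isT); lia.
exists k, l; split=> // j; rewrite def_k; split; last first.
  by rewrite Ind_rot0 // groupMl ?mem_cycle ?notR_s.
rewrite Ind_rotE rot_conjs ?mem_cycle // lin_charV_conj ?mem_cycle //.
rewrite lin_charX ?cycle_id // lr /two_cos ReE mulrC divfK ?(pnatr_eq0 _ 2) //.
by rewrite /zeta -!exprM mulnA.
Qed.

Lemma rot_char_faithful (l : Iirr R) x : 'chi_l r = zeta -> x \in R -> 'chi_l x = 1 -> x = 1%g.
Proof.
move=> lr /cycleP[i ->].
have Ll : 'chi_l \is a linear_char by apply: irr_cyclic_lin (cycle_cyclic r).
rewrite lin_charX ?cycle_id // lr => /eqP; rewrite -(prim_order_dvd prim_zeta).
by rewrite -order_r order_dvdn => /eqP.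
Qed.

(** * Characters induced from [<z, u>] *)

Local Notation z := (r ^+ m./2)%g.

Lemma in_R_z : z \in R. Proof. exact: mem_cycle. Qed.
Lemma in_W_z : z \in W. Proof. by rewrite groupX ?in_W_r. Qed.

Lemma rot_invol x : x \in R -> (x ^+ 2 = 1)%g -> x = 1%g \/ ~~ odd m /\ x = z.
Proof.
move=> /cyclePmin[i]; rewrite order_r => lt_i ->; rewrite -expgM => /eqP.
rewrite -order_dvdn order_r => /dvdnP[[|[|k]] def_i]; last by nia.
  by left; have -> : i = 0%N by lia.
by right; split; [lia | congr (_ ^+ _)%g; lia].
Qed.

Lemma lin_z (lam : 'CF(W)) : lam \is a linear_char -> lam z = (lam s * lam t) ^+ m./2.
Proof.
by move=> Llam; rewrite lin_charX ?in_W_r // lin_charM ?in_W_s ?in_W_t.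
Qed.

(** Here [m./2] is odd, and an odd power of a sign is the sign itself. *)
Lemma lin_z_mod4 (lam : 'CF(W)) : (m %% 4 = 2)%N -> lam \is a linear_char ->
  lam z = lam s * lam t.
Proof.
move=> m2 Llam; have m2_odd : odd m./2 by lia.
rewrite lin_z // -[X in _ ^+ X](odd_double_half m./2) m2_odd add1n exprS -mul2n exprM.
by rewrite [(_ * _) ^+ 2]exprMn !lin_sqr ?in_W_s ?in_W_t // mulr1 expr1n mulr1.
Qed.

(** Every reflection in [H] is a rotation in [H] times [u], so a subgroup containing [u] is
    determined by its rotations. *)
Lemma sub_of_rot_sub (H K : {group gT}) (u : gT) : H \subset W -> u \in S -> u \in H ->
  u \in K -> H :&: R \subset K -> H \subset K.
Proof.
move=> sHW uS uH uK sK; apply/subsetP=> x xH; have xW := subsetP sHW x xH.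
have [xR|xR] := boolP (x \in R); first by rewrite (subsetP sK) // inE xH.
rewrite -(groupMr x uK) (subsetP sK) // inE groupM //=.
by rewrite mem_rotM ?(letterW uS) // (negPf xR) (negPf (letter_notR uS)).
Qed.

(** For even [m] and [u] in [{s, t}] this is a Klein four-group. Both choices of [u] arise from the
    members of a model. *)
Definition klein (u : gT) : {group gT} := <<[set z; u]>>%G.

Section EvenKlein.

Hypothesis m_even : ~~ odd m.

Lemma z_sqr : (z ^+ 2 = 1)%g.
Proof. by rewrite -expgM muln2 even_halfK // st_m. Qed.

Lemma order_z : #[z] = 2%N.
Proof.
apply: nt_prime_order => //; first exact: z_sqr.
by rewrite -order_dvdn order_r; apply/negP=> /dvdn_leq; lia.
Qed.

Variable u : gT.
Hypothesis uS : u \in S.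

Lemma klein_subW : klein u \subset W.
Proof. by rewrite gen_subG; apply/subsetP=> x /set2P[] ->; rewrite ?in_W_z ?letterW. Qed.

Lemma klein_z : z \in klein u. Proof. by rewrite mem_gen ?set21. Qed.
Lemma klein_u : u \in klein u. Proof. by rewrite mem_gen ?set22. Qed.

Lemma klein_notR : ~~ (klein u \subset R).
Proof. by apply/subsetPn; exists u; rewrite ?klein_u ?letter_notR. Qed.

Lemma klein_capR : klein u :&: R = <[z]>%g.
Proof.
apply/eqP; rewrite eqEsubset subsetI !cycle_subG klein_z in_R_z !andbT.
have cuz : u \in 'N(<[z]>%g).
  apply/(subsetP (cent_sub _)); rewrite cent_cycle; apply/cent1P/commgP.
  rewrite commgEr (refl_conj _ (letterW uS) (letter_notR uS)) ?groupV ?in_R_z //.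
  by rewrite invgK -expg2 z_sqr.
have skl : klein u \subset (<[z]> * <[u]>)%g.
  rewrite -norm_joinEr ?cycle_subG // gen_subG; apply/subsetP=> x.
  by case/set2P=> ->; rewrite mem_gen // inE cycle_id ?orbT.
apply/subsetP=> x /setIP[/(subsetP skl)/mulsgP[a b az bu ->]].
have aR : a \in R by apply: subsetP az; rewrite cycle_subG in_R_z.
move: bu; rewrite cycle2g ?refl_order // => /set2P[] ->; first by rewrite mulg1.
by rewrite groupMl // (negPf (letter_notR uS)).
Qed.

Lemma card_klein : #|klein u| = 4%N.
Proof. by rewrite card_notsubR ?klein_subW ?klein_notR // klein_capR -orderE order_z. Qed.

Lemma klein_deg (lam : 'CF(W)) : lam \is a linear_char ->
  'Ind[W, klein u] ('Res lam) 1%g = (m./2)%:R.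
Proof.
move=> Llam; rewrite cfInd1 ?klein_subW // lin_char1 ?cfRes_lin_char // mulr1.
by rewrite -divgS ?klein_subW // card_klein cardW; congr _%:R; lia.
Qed.

Lemma klein_mult_nonlin (lam : 'CF(W)) (l : Iirr R) : lam \is a linear_char ->
  '['Ind[W, klein u] ('Res lam), 'Ind[W, R] 'chi_l] = (lam z == 'chi_l z)%:R.
Proof.
move=> Llam; have Ll : 'chi_l \is a linear_char by apply: irr_cyclic_lin (cycle_cyclic r).
rewrite mult_nonlin ?klein_subW // (negPf klein_notR) mul1r klein_capR.
congr (nat_of_bool _)%:R; apply/forall_inP/idP=> [-> //|/eqP eqz x /cycleP[i ->]].
  exact: cycle_id.
by rewrite (lin_charX Llam _ in_W_z) (lin_charX Ll _ in_R_z) eqz.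
Qed.

Lemma rot_char_z (l : Iirr R) : ('chi_l z == 1) = ('chi_l z != -1).
Proof.
have Ll : 'chi_l \is a linear_char by apply: irr_cyclic_lin (cycle_cyclic r).
have /eqP : 'chi_l z ^+ 2 = 1 by rewrite -lin_charX ?in_R_z // z_sqr lin_char1.
have N1 : (-1 == 1 :> algC) = false by have := signr_eqN1 false; rewrite eq_sym.
by rewrite sqrf_eq1 => /orP[]/eqP->; rewrite eqxx ?N1 // eq_sym N1.
Qed.

(** Since [lam z = lam s * lam t], the signs at [z] and [u] determine those at [s] and [t]; only
    [lam] itself can agree with [lam] on [klein u]. *)
Lemma klein_mult_lin (lam mu : 'CF(W)) : (m %% 4 = 2)%N ->
  lam \is a linear_char -> mu \is a linear_char ->
  '['Ind[W, klein u] ('Res lam), mu] = (lam == mu)%:R.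
Proof.
move=> m2 Llam Lmu; rewrite mult_lin ?klein_subW //; congr (nat_of_bool _)%:R.
apply/forall_inP/eqP=> [eqV | -> //].
have /eqP := eqV z klein_z; have /eqP := eqV u klein_u; rewrite !lin_z_mod4 //.
case/set2P: uS => -> eq_u eq_z; apply: lin_eq => //.
  by move: eq_z; rewrite eq_u; apply/mulfI; rewrite lin_char_neq0 ?in_W_s.
by move: eq_z; rewrite eq_u; apply/mulIf; rewrite lin_char_neq0 ?in_W_t.
Qed.

End EvenKlein.

(** The multiplicity formulas depend only on [lam] and not on [u]. *)
Lemma klein_indep (u : gT) (lam : 'CF(W)) : (m %% 4 = 2)%N -> u \in S ->
  lam \is a linear_char -> 'Ind[W, klein u] ('Res lam) = 'Ind[W, klein s] ('Res lam).
Proof.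
move=> m2 uS Llam; have m_even : ~~ odd m by lia.
rewrite [LHS]cfun_sum_cfdot [RHS]cfun_sum_cfdot; apply: eq_bigr => k _; congr (_ *: _).
have [Lk|Lk] := boolP ('chi_k \is a linear_char).
  by rewrite !klein_mult_lin ?set21.
by have [l ->] := nonlin_Ind Lk; rewrite !klein_mult_nonlin ?set21.
Qed.

(** * Characters induced from [<[u]>] *)

Section Reflection.

Variable u : gT.
Hypothesis uS : u \in S.

Lemma refl_subW : <[u]>%g \subset W. Proof. by rewrite cycle_subG letterW. Qed.

Lemma refl_notR : ~~ (<[u]>%g \subset R). Proof. by rewrite cycle_subG letter_notR. Qed.

Lemma refl_capR : <[u]>%g :&: R = 1%g.
Proof. by rewrite prime_TIg ?refl_notR // -orderE refl_order. Qed.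

Lemma refl_deg (lam : 'CF(W)) : lam \is a linear_char ->
  'Ind[W, <[u]>] ('Res lam) 1%g = m%:R.
Proof.
move=> Llam; rewrite cfInd1 ?refl_subW // lin_char1 ?cfRes_lin_char // mulr1.
by rewrite -divgS ?refl_subW // -orderE (refl_order uS) cardW mulKn.
Qed.

Lemma refl_mult_nonlin (lam : 'CF(W)) (k : Iirr W) : lam \is a linear_char ->
  'chi_k \isn't a linear_char -> '['Ind[W, <[u]>] ('Res lam), 'chi_k] = 1.
Proof.
move=> Llam /nonlin_Ind[l ->].
have Ll : 'chi_l \is a linear_char by apply: irr_cyclic_lin (cycle_cyclic r).
rewrite mult_nonlin ?refl_subW // (negPf refl_notR) mul1r refl_capR.
suff -> : [forall x in [1 gT]%g, lam x == 'chi_l x] by [].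
by apply/forall_inP=> x /set1P->; rewrite !lin_char1.
Qed.

Lemma refl_mult_lin (lam mu : 'CF(W)) : lam \is a linear_char -> mu \is a linear_char ->
  '['Ind[W, <[u]>] ('Res lam), mu] = (lam u == mu u)%:R.
Proof.
move=> Llam Lmu; rewrite mult_lin ?refl_subW //; congr (nat_of_bool _)%:R.
apply/forall_inP/idP=> [-> //|/eqP eq_u x /cycleP[i ->]]; first exact: cycle_id.
by rewrite !lin_charX ?letterW // eq_u.
Qed.

End Reflection.

(** * Allowed characters *)

Lemma lin_extend (u : gT) (c : bool) : u \in S ->
  exists2 lam : 'CF(W), lam \is a linear_char & lam u = (-1) ^+ c.
Proof.
(* Equal signs on [s] and [t] are admissible for every [m]. *)
move=> uS; have [|i] := @lin_exists c c; first by rewrite eqxx orbT.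
by rewrite inE => Li [is_ it_]; exists 'chi_i => //; case/set2P: uS => ->.
Qed.

(** For a proper subset [J] the character [sigma] lives on [<<J>>] only. As [H] is trivial or
    [<[u]>], the restriction is fixed by at most one sign, which a linear character of [W]
    realises. *)
Lemma Res_refl_extend (u : gT) (K H : {group gT}) (sigma : 'CF(K)) : u \in S ->
    sigma \is a linear_char -> H \subset K -> H \subset <[u]>%g ->
  exists2 lam : 'CF(W), lam \is a linear_char & 'Res[H] sigma = 'Res[H] lam.
Proof.
move=> uS Lsigma sHK sHu.
have sHW : H \subset W by apply: subset_trans sHu (refl_subW uS).
have [uH|uH] := boolP (u \in H); last first.
  exists 1; first exact: cfun1_lin_char.
  have H1 : H :=: 1%g.
    rewrite -(setIidPl sHu) setIC; apply: prime_TIg; last by rewrite cycle_subG.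
    by rewrite -orderE refl_order.
  apply/cfun_inP=> x xH; rewrite !cfResE // cfun1E (subsetP sHW) //.
  by move: xH; rewrite H1 => /set1P->; rewrite lin_char1.
have uK := subsetP sHK u uH.
have [c sigma_u] : exists c : bool, sigma u = (-1) ^+ c.
  have /eqP : sigma u ^+ 2 = 1 by rewrite -lin_charX // expg2 letter_mul // lin_char1.
  rewrite sqrf_eq1 => /orP[]/eqP->; by [exists false | exists true].
have [lam Llam lam_u] := lin_extend c uS; exists lam => //.
apply/cfun_inP=> x xH; rewrite !cfResE //.
have /cycleP[i ->] := subsetP sHu x xH.
by rewrite !lin_charX ?(letterW uS) // lam_u sigma_u.
Qed.

(** For [J = S] the analysis of (QP1) applies. Otherwise [H] lies in some [<[u]>], so it contains
    [u] or is trivial and lies in [R]. *)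
Lemma allowed_shape (chi : 'CF(W)) : allowed_char S chi ->
  exists (H : {group gT}) (lam : 'CF(W)), [/\ H \subset W, lam \is a linear_char,
    chi = 'Ind[W, H] ('Res[H] lam) & H \subset R \/ exists2 u, u \in S & u \in H].
Proof.
case=> J [H [sigma [sJS qpH Lsigma defchi]]]; have [sHJ _] := qpH.
have sHW : H \subset W by rewrite -genW; apply: subset_trans sHJ (genS sJS).
have [eqJ|neqJ] := eqVneq J S.
  subst J; move: sigma Lsigma defchi; rewrite genW => sigma Lsigma defchi.
  exists H, sigma; split=> //.
  have [sHR|nHR] := boolP (H \subset R); [by left | right].
  case: (qp_contains_letter sHW qpH nHR) => [sH|tH].
    by exists s; rewrite ?set21.
  by exists t; rewrite ?set22.
have [u uS sJu] : exists2 u, u \in S & J \subset [set u].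
  have [sJ|sJ] := boolP (s \in J); [have [tJ|tJ] := boolP (t \in J) |].
  - by case/negP: neqJ; rewrite eqEsubset sJS; apply/subsetP=> x /set2P[] ->.
  - exists s; rewrite ?set21 //; apply/subsetP=> x xJ; rewrite inE.
    case/set2P: (subsetP sJS x xJ) => def_x; first by rewrite def_x.
    by case/negP: tJ; rewrite -def_x.
  - exists t; rewrite ?set22 //; apply/subsetP=> x xJ; rewrite inE.
    case/set2P: (subsetP sJS x xJ) => def_x; last by rewrite def_x.
    by case/negP: sJ; rewrite -def_x.
have sHu : H \subset <[u]>%g by apply: subset_trans sHJ (genS sJu).
have [lam Llam eqRes] := @Res_refl_extend u <<J>>%G H sigma uS Lsigma sHJ sHu.
exists H, lam; split; rewrite ?defchi ?eqRes //.
have [uH|uH] := boolP (u \in H); first by right; exists u.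
left; rewrite -(setIidPl sHu) setIC prime_TIg ?sub1G //; last by rewrite cycle_subG.
by rewrite -orderE refl_order.
Qed.

Lemma allowed_Ind (H : {group gT}) (lam : 'CF(W)) : H \subset W ->
  lam \is a linear_char -> qp_subgroup S H -> allowed_char S ('Ind[W, H] ('Res[H] lam)).
Proof. by move=> sHW Llam qpH; exists S, H; rewrite genW; exists lam. Qed.

Lemma allowed_Ind_letter (u : gT) (H : {group gT}) (lam : 'CF(W)) : H \subset W ->
  lam \is a linear_char -> u \in S -> u \in H -> allowed_char S ('Ind[W, H] ('Res[H] lam)).
Proof.
move=> sHW Llam uS uH; apply: allowed_Ind => //; apply: qp_of_mem_gen => //.
by case/set2P: uS uH => ->; [left | right].
Qed.

Lemma allowed_lin (lam : 'CF(W)) : lam \is a linear_char -> allowed_char S lam.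
Proof.
move=> Llam; rewrite -[lam]cfInd_id -{1}[lam]cfRes_id.
by apply: (@allowed_Ind_letter s); rewrite ?set21 ?in_W_s.
Qed.

Lemma lin_mul_self (lam : 'CF(W)) : lam \is a linear_char -> lam * lam = 1.
Proof.
by move=> Llam; apply/cfun_inP=> x xW; rewrite cfunE cfun1E xW -expr2 lin_sqr.
Qed.

(** The product [nu] takes the values 1 and -1, so [1 + nu] is twice the indicator of its kernel.
    Pairing with [1] shows that the kernel has index 2, whence [1 + nu] is induced from its trivial
    character; multiplying by ['chi_i] gives the pair. *)
Lemma joined_lin (i j : Iirr W) : i \in lin_irr -> j \in lin_irr -> i != j ->
  joined 'chi_i 'chi_j ('chi_i + 'chi_j) /\ allowed_char S ('chi_i + 'chi_j).
Proof.
rewrite !inE => Li Lj neq_ij; set nu := 'chi_i * 'chi_j.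
have Lnu : nu \is a linear_char by rewrite rpredM.
have nu_neq1 : nu != 1.
  apply: contra neq_ij => /eqP nu1; apply/eqP/irr_inj.
  by rewrite -['chi_j]mul1r -(lin_mul_self Li) -mulrA -/nu nu1 mulr1.
have nsKW : cfker nu <| W := cfker_normal nu.
have def1nu : 1 + nu = 2 *: '1_(cfker nu).
  apply/cfun_inP=> x xW; rewrite cfunE [in RHS]cfunE cfuniE // cfkerEchar ?lin_charW //.
  rewrite inE xW cfun1E xW lin_char1 //=; have [b ->] := lin_pm1 Lnu xW.
  case: b; rewrite /= ?expr0 ?expr1 ?mulr1n ?eqxx ?mulr1 // subrr.
  by rewrite eq_sym (signr_eqN1 false) mulr0.
have indexK : #|W : cfker nu| = 2%N.
  have := congr1 (fun f => '[f, 1]) def1nu; rewrite /= cfdotDl cfdotZl.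
  rewrite (lin_cfdot (cfun1_lin_char W) (cfun1_lin_char W)).
  rewrite (lin_cfdot Lnu (cfun1_lin_char W)) eqxx (negPf nu_neq1) addr0.
  rewrite -cfuniG cfdot_cfuni ?normal_refl // (setIidPl (cfker_sub _)) => eq1.
  apply/eqP; rewrite -(eqr_nat algC) natf_indexg ?cfker_sub //; apply/eqP.
  move: (esym eq1); rewrite mulrA => /divr1_eq <-.
  by rewrite mulfK // neq0CG.
have eqInd : 'chi_i + 'chi_j = 'Ind[W, cfker nu] ('Res[cfker nu] 'chi_i).
  rewrite -['Res[cfker nu] 'chi_i]mul1r cfIndM ?cfker_sub // cfInd_cfun1 //.
  rewrite indexK -def1nu mulrDl mul1r -mulrA mulrCA; congr (_ + _).
  by rewrite lin_mul_self // mulr1.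
split; first by split.
rewrite eqInd; apply: allowed_Ind; rewrite ?cfker_sub //.
by apply: qp_of_index2; rewrite ?cfker_sub.
Qed.

(** * Completing a family by linear characters *)

(** Each degree [d] is 1 or 2, so [2 * d] is [d ^+ 2], plus 1 when [d = 1]; the squares add up to
    [#|W|]. *)
Lemma sum_irr_deg : 2 * \sum_i 'chi[W]_i 1%g = (2 * (m + gcdn m 2))%:R.
Proof.
have sum_sq : \sum_i 'chi[W]_i 1%g ^+ 2 = (2 * m)%:R.
  have := congr1 (fun f : 'CF(W) => f 1%g) (cfReg_sum W).
  rewrite /= cfRegE eqxx mulr1n cardW sum_cfunE => ->.
  by apply: eq_bigr => i _; rewrite cfunE expr2.
rewrite mulnDr natrD -sum_sq -card_lin -sum1_card natr_sum.
rewrite [X in _ + X]big_mkcond -big_split /= mulr_sumr.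
apply: eq_bigr => i _; rewrite inE; case: ifP => Li; last first.
  by rewrite irr_deg2 ?Li // addr0 expr2.
by rewrite lin_char1 // expr1n mulr1.
Qed.

(* The number of missing linear characters comes from comparing the degrees of
   [B] and of the sum of all irreducible characters. *)
Lemma missing_complement (B : 'CF(W)) :
    (forall k, 'chi_k \isn't a linear_char -> '[B, 'chi_k] = 1) ->
    (forall k, 'chi_k \is a linear_char -> exists b : bool, '[B, 'chi_k] = b%:R) ->
    B 1%g = m%:R ->
  \sum_i 'chi_i = B + \sum_(i in missing_linear B) 'chi_i /\
  #|missing_linear B| = gcdn m 2.
Proof.
move=> Bnonlin Blin B1.
have sumE : \sum_i 'chi_i = B + \sum_(i in missing_linear B) 'chi_i.
  rewrite {1}[B]cfun_sum_cfdot [X in _ + X]big_mkcond -big_split /=.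
  apply: eq_bigr => k _; rewrite inE irr_consttE.
  have [Lk|Lk] := boolP ('chi_k \is a linear_char); last by rewrite Bnonlin // scale1r addr0.
  have [b ->] := Blin k Lk; case: b; first by rewrite oner_eq0 scale1r addr0.
  by rewrite eqxx scale0r add0r.
split=> //; have := sum_irr_deg.
have := congr1 (fun f : 'CF(W) => f 1%g) sumE; rewrite /= cfunE !sum_cfunE B1 => ->.
rewrite [X in _ + X](eq_bigr (fun=> 1)) => [|i]; last first.
  by rewrite inE => /andP[Li _]; rewrite lin_char1.
rewrite sumr_const -natrD -natrM => /eqP; by rewrite eqr_nat eqn_pmul2l // eqn_add2l => /eqP.
Qed.

Lemma refl_complement (u : gT) (lam : 'CF(W)) (B := 'Ind[W, <[u]>] ('Res[<[u]>] lam)) :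
    u \in S -> lam \is a linear_char ->
  \sum_i 'chi_i = B + \sum_(i in missing_linear B) 'chi_i /\
  #|missing_linear B| = gcdn m 2.
Proof.
move=> uS Llam; apply: missing_complement => [k Lk|k Lk|].
- exact: refl_mult_nonlin.
- by rewrite refl_mult_lin //; exists (lam u == 'chi_k u).
- exact: refl_deg.
Qed.

(** Each nonlinear character is induced from some [xi] with [xi z] equal to [-1] or [1], so exactly
    one of the two summands contains it. As [lam1] and [lam2] differ at [z], no linear character
    occurs twice. *)
Lemma klein_complement (u1 u2 : gT) (lam1 lam2 : 'CF(W))
    (B := 'Ind[W, klein u1] ('Res[klein u1] lam1) + 'Ind[W, klein u2] ('Res[klein u2] lam2)) :
    (m %% 4 = 2)%N -> u1 \in S -> u2 \in S ->
    lam1 \is a linear_char -> lam2 \is a linear_char -> lam1 z = -1 -> lam2 z = 1 ->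
  \sum_i 'chi_i = B + \sum_(i in missing_linear B) 'chi_i /\
  #|missing_linear B| = gcdn m 2.
Proof.
move=> m2 u1S u2S L1 L2 lam1z lam2z; have m_even : ~~ odd m by lia.
apply: missing_complement => [k /nonlin_Ind[l ->]|k Lk|].
- rewrite cfdotDl !klein_mult_nonlin // lam1z lam2z ![_ == 'chi_l z]eq_sym.
  by rewrite rot_char_z //; case: ('chi_l z == -1); rewrite ?addr0 ?add0r.
- rewrite cfdotDl !klein_mult_lin //; have [eq1|_] := eqVneq lam1 'chi_k; last first.
    by exists (lam2 == 'chi_k); rewrite add0r.
  have [eq2|_] := eqVneq lam2 'chi_k; last by exists true; rewrite addr0.
  have := signr_eqN1 false; rewrite expr0 -lam1z -lam2z eq1 eq2.
  by rewrite eqxx.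
- rewrite cfunE !klein_deg // -natrD addnn; congr _%:R.
  by have := odd_double_half m; rewrite (negPf m_even).
Qed.

(** The flag is [true] for split and [false] for joined. Summing over the missing set avoids
    choosing an order of the pair. *)
Definition completion (base : seq 'CF(W)) (b : bool) : seq 'CF(W) :=
  let D := missing_linear (\sum_(chi <- base) chi) in
  base ++ (if b then [seq 'chi_i | i <- enum D] else [:: \sum_(i in D) 'chi_i]).

Lemma perm_enum2 (T : finType) (i j : T) : i != j -> perm_eq (enum [set i; j]) [:: i; j].
Proof.
move=> neq; apply: uniq_perm; rewrite ?enum_uniq /= ?inE ?neq // => x.
by rewrite mem_enum !inE.
Qed.

Lemma append_two_missingP (base : seq 'CF(W)) (M : {mset 'CF(W)}) :
  #|missing_linear (\sum_(chi <- base) chi)| = 2%N ->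
  append_two_missing base M <-> exists b, M = seq_mset (completion base b).
Proof.
move=> card2; rewrite /completion; set D := missing_linear _ in card2 *.
split=> [[i [j [neq defD defM]]] | [b ->]].
  case: defM => [->|[_ [-> _] ->]].
    exists true; apply/eq_seq_msetP; rewrite perm_cat2l.
    by rewrite perm_sym (perm_map _ (_ : perm_eq _ [:: i; j])) // [D]defD perm_enum2.
  exists false; apply/eq_seq_msetP; rewrite perm_cat2l.
  by rewrite [D]defD big_setU1 ?inE ?big_set1 //=.
have /cards2P[i [j [neq defD]]] : #|D| == 2%N by apply/eqP.
exists i, j; split=> //; case: b; [left | right].
  apply/eq_seq_msetP; rewrite perm_cat2l (perm_map _ (_ : perm_eq _ [:: i; j])) //.
  by rewrite defD perm_enum2.
have [Li Lj] : i \in lin_irr /\ j \in lin_irr.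
  have : i \in D by rewrite defD set21.
  have : j \in D by rewrite defD set22.
  by rewrite !inE => /andP[-> _] /andP[-> _].
exists ('chi_i + 'chi_j); first by have [] := joined_lin Li Lj neq.
by rewrite defD big_setU1 ?inE ?big_set1.
Qed.

Lemma char_deg_ge1 (chi : 'CF(W)) : chi \is a character -> chi != 0 -> 1 <= chi 1%g.
Proof.
move=> Nchi; rewrite -char1_gt0 //; have /natrP[d ->] := Cnat_char1 Nchi.
by rewrite ltr0n ler1n.
Qed.

(** This bounds the number of members left once the base of a model is removed. *)
Lemma size_le_deg (N : seq 'CF(W)) :
    (forall chi, chi \in N -> chi \is a character /\ chi != 0) ->
  (size N)%:R <= (\sum_(chi <- N) chi) 1%g.
Proof.
move=> charN; rewrite sum_cfunE -sum1_size natr_sum !big_seq.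
by apply: ler_sum => chi /charN[]; apply: char_deg_ge1.
Qed.

Lemma deg_missing (D : {set Iirr W}) : D \subset lin_irr ->
  (\sum_(i in D) 'chi_i) 1%g = #|D|%:R.
Proof.
move=> sDL; rewrite sum_cfunE (eq_bigr (fun=> 1)) ?sumr_const // => i iD.
by rewrite lin_char1 //; have := subsetP sDL i iD; rewrite inE.
Qed.

Lemma deg1_lin (chi : 'CF(W)) : chi \is a character -> chi 1%g = 1 -> chi \is a linear_char.
Proof. by move=> Nchi chi1; rewrite qualifE /= Nchi chi1 eqxx. Qed.

Lemma sum_eq_one_lin (N : seq 'CF(W)) (i : Iirr W) : i \in lin_irr ->
    (forall chi, chi \in N -> chi \is a character /\ chi != 0) ->
    \sum_(chi <- N) chi = 'chi_i -> N = [:: 'chi_i].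
Proof.
rewrite inE => Li charN sumN; have := size_le_deg charN.
rewrite sumN lin_char1 // (ler_nat _ _ 1) => sz; case: N sz charN sumN => [|x [|]] //= _ charN.
  by rewrite big_nil => /eqP; rewrite eq_sym (negPf (irr_neq0 i)).
by rewrite big_seq1 => ->.
Qed.

(** The sum has degree 2, so there are at most two terms. A single term is the joined pair; two
    terms have degree 1 each and are the two irreducible summands. *)
Lemma sum_eq_two_lin (N : seq 'CF(W)) (D : {set Iirr W}) : D \subset lin_irr -> #|D| = 2%N ->
    (forall chi, chi \in N -> chi \is a character /\ chi != 0) ->
    \sum_(chi <- N) chi = \sum_(i in D) 'chi_i ->
  exists b, perm_eq N (if b then [seq 'chi_i | i <- enum D] else [:: \sum_(i in D) 'chi_i]).
Proof.
move=> sDL cardD charN sumN; have := size_le_deg charN.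
have degD := deg_missing sDL; rewrite cardD in degD.
rewrite sumN degD ler_nat => sz.
case: N sz charN sumN => [|x [|y [|]]] //= _ charN; rewrite ?big_seq1 ?big_nil.
- by move=> sum0; move: degD; rewrite -sum0 cfunE => /eqP; rewrite eq_sym (pnatr_eq0 _ 2).
- by move=> ->; exists false.
rewrite big_cons big_seq1 => sumN; exists true.
have [Nx nzx] := charN x (mem_head _ _).
have [Ny nzy] : y \is a character /\ y != 0 by apply: charN; rewrite !inE eqxx orbT.
have x1 := char_deg_ge1 Nx nzx; have y1 := char_deg_ge1 Ny nzy.
have sum2 : x 1%g + y 1%g = 1 + 1 by rewrite -[RHS]degD -sumN cfunE.
have ex : x 1%g = 1.
  by apply/eqP; rewrite eq_le x1 andbT -(lerD2r (y 1%g)) sum2 lerD2l.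
have ey : y 1%g = 1 by move: sum2; rewrite ex => /addrI.
have /irrP[a defx] := lin_char_irr (deg1_lin Nx ex).
have /irrP[b defy] := lin_char_irr (deg1_lin Ny ey).
have /cards2P[i [j [neq defD]]] : #|D| == 2%N by apply/eqP.
rewrite perm_sym (perm_trans (perm_map _ (_ : perm_eq _ [:: i; j]))) ?defD ?perm_enum2 //=.
have sumE : 'chi_a + 'chi_b = 'chi_i + 'chi_j.
  by rewrite -defx -defy sumN defD big_setU1 ?inE ?big_set1.
(* Pairing both sides with ['chi_a] finds it among the two summands; cancelling it then identifies
   ['chi_b]. *)
have : (a == i) || (a == j).
  have := congr1 (fun f => '[f, 'chi_a]) sumE; rewrite /= !cfdotDl !cfdot_irr eqxx.
  rewrite ![_ == a]eq_sym; case: (a == i); case: (a == j) => //= /eqP.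
  by rewrite addr0 -(natrD _ 1) pnatr_eq0.
rewrite defx defy; case/orP=> /eqP eqa; rewrite eqa in sumE *.
  by move/addrI: sumE => ->.
move: sumE; rewrite [RHS]addrC => /addrI->.
exact/permPl/(perm_catC [:: _] [:: _]).
Qed.

Lemma allowed_char_neq0 (chi : 'CF(W)) : allowed_char S chi ->
  chi \is a character /\ chi != 0.
Proof.
case/allowed_shape=> H [lam [sHW Llam -> _]].
have Nchi : 'Ind[W, H] ('Res[H] lam) \is a character.
  by rewrite cfInd_char ?lin_charW ?cfRes_lin_char.
split=> //; rewrite -char1_eq0 // cfInd1 // lin_char1 ?cfRes_lin_char // mulr1.
by rewrite pnatr_eq0 -lt0n indexg_gt0.
Qed.

(* On [H :&: R] the character agrees with [lam], which has values [1] and [-1];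
   the last hypothesis thus leaves only the involutions [1] and [z] there. *)
Lemma member_shape (H : {group gT}) (lam : 'CF(W)) (l : Iirr R) : H \subset W ->
    lam \is a linear_char -> H \subset R \/ (exists2 u, u \in S & u \in H) ->
    '['Ind[W, H] ('Res[H] lam), 'Ind[W, R] 'chi_l] != 0 ->
    '['Ind[W, H] ('Res[H] lam), 'Ind[W, R] 'chi_l] <= 1 ->
    (forall x, x \in R -> 'chi_l x ^+ 2 = 1 -> (x ^+ 2 = 1)%g) ->
  exists2 u, u \in S & H = <[u]>%G \/ [/\ ~~ odd m, H = klein u & lam z = 'chi_l z].
Proof.
move=> sHW Llam shapeH mult_neq0 mult_le1 l_sqr.
have Ll : 'chi_l \is a linear_char by apply: irr_cyclic_lin (cycle_cyclic r).
move: mult_neq0 mult_le1; rewrite mult_nonlin //.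
case: forall_inP => [eqH _|]; last by rewrite mulr0 eqxx.
case: ifP => [_|nHR _]; first by rewrite mulr1 (ler_nat _ 2 1).
case: shapeH => [sHR|[u uS uH]]; first by rewrite sHR in nHR.
exists u => //; have eqHR x : x \in H -> x \in R -> lam x = 'chi_l x.
  by move=> xH xR; apply/eqP/eqH; rewrite inE xH.
have invHR x : x \in H -> x \in R -> x = 1%g \/ ~~ odd m /\ x = z.
  move=> xH xR; apply: rot_invol => //; apply: l_sqr => //.
  by rewrite -eqHR // lin_sqr // (subsetP sHW).
have [/andP[m_even zH]|no_z] := boolP (~~ odd m && (z \in H)); [right | left].
  split=> //; last by rewrite eqHR ?in_R_z.
  apply: val_inj; apply/eqP; rewrite /= eqEsubset gen_subG.
  rewrite (@sub_of_rot_sub _ (klein u) u) ?klein_u //=.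
    by apply/subsetP=> x /set2P[] ->.
  apply/subsetP=> x /setIP[xH xR].
  by case: (invHR x xH xR) => [->|[_ ->]]; rewrite ?group1 ?klein_z.
apply: val_inj; apply/eqP; rewrite /= eqEsubset cycle_subG uH andbT.
apply: (sub_of_rot_sub sHW uS uH (cycle_id u)).
apply/subsetP=> x /setIP[xH xR].
case: (invHR x xH xR) => [->|[m_even def_x]]; first exact: group1.
by case/negP: no_z; rewrite m_even -def_x.
Qed.

Lemma cfdot_sum_all_irr (k : Iirr W) : '[\sum_i 'chi_i, 'chi_k] = 1.
Proof.
rewrite cfdot_suml (bigD1 k) //= cfnorm_irr big1 ?addr0 // => i /negPf nik.
by rewrite cfdot_irr nik.
Qed.

(** * Classification of the models *)

Section Model.

Variable M : {mset 'CF(W)}.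
Hypothesis modelM : qp_gelfand_model S M.

Lemma model_mult (k : Iirr W) : \sum_(chi <- M) '[chi, 'chi_k] = 1.
Proof. by case: modelM => _ sumM; rewrite -cfdot_suml sumM cfdot_sum_all_irr. Qed.

Lemma model_char (chi : 'CF(W)) : chi \in (M : seq _) -> chi \is a character /\ chi != 0.
Proof. by case: modelM => allM _ /allM; apply: allowed_char_neq0. Qed.

Lemma model_mult_ge0 (k : Iirr W) (chi : 'CF(W)) :
  chi \in (M : seq _) -> 0 <= '[chi, 'chi_k].
Proof. by move=> /model_char[Nchi _]; apply/natr_ge0/Cnat_cfdot_char_irr. Qed.

Lemma model_mult_cat_le1 (k : Iirr W) (base N : seq 'CF(W)) :
  perm_eq M (base ++ N) -> \sum_(chi <- base) '[chi, 'chi_k] <= 1.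
Proof.
move=> permM; rewrite -[leRHS](model_mult k) (perm_big _ permM) big_cat /= lerDl.
rewrite big_seq; apply: sumr_ge0 => chi chiN; apply: model_mult_ge0.
by rewrite (perm_mem permM) mem_cat chiN orbT.
Qed.

Lemma model_constituent (k : Iirr W) :
  exists2 chi, chi \in (M : seq _) & '[chi, 'chi_k] != 0.
Proof.
apply/hasP; apply: contraT => /hasPn none; have := model_mult k.
rewrite big_seq big1 => [/eqP|chi /none]; first by rewrite eq_sym oner_eq0.
by rewrite negbK => /eqP.
Qed.

Lemma model_member (k : Iirr W) (l : Iirr R) (chi : 'CF(W)) :
    'chi_k = 'Ind[W, R] 'chi_l -> chi \in (M : seq _) -> '[chi, 'chi_k] != 0 ->
    (forall x, x \in R -> 'chi_l x ^+ 2 = 1 -> (x ^+ 2 = 1)%g) ->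
  exists2 u, u \in S & exists2 lam : 'CF(W), lam \is a linear_char &
    chi = 'Ind[W, <[u]>] ('Res[<[u]>] lam) \/
    [/\ ~~ odd m, chi = 'Ind[W, klein u] ('Res[klein u] lam) & lam z = 'chi_l z].
Proof.
move=> def_k chiM mult_neq0 l_sqr; case: modelM => /(_ chi chiM) allow _.
have mult_le1 : '[chi, 'chi_k] <= 1.
  have := @model_mult_cat_le1 k [:: chi] _ (perm_to_rem chiM).
  by rewrite big_seq1.
case/allowed_shape: allow mult_neq0 mult_le1 => H [lam [sHW Llam -> shapeH]].
rewrite def_k => mult_neq0 mult_le1.
have [u uS shape] := member_shape sHW Llam shapeH mult_neq0 mult_le1 l_sqr.
exists u => //; exists lam => //.
by case: shape => [->|[m_even -> lam_z]]; [left | right].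
Qed.

Lemma model_cases :
  (exists (u : gT) (lam : 'CF(W)) (N : seq 'CF(W)), [/\ u \in S, lam \is a linear_char
     & perm_eq M ('Ind[W, <[u]>] ('Res[<[u]>] lam) :: N)]) \/
  (m %% 4 = 2)%N /\ (exists (u1 u2 : gT) (lam1 lam2 : 'CF(W)) (N : seq 'CF(W)),
     [/\ u1 \in S /\ u2 \in S, lam1 \is a linear_char, lam2 \is a linear_char,
         lam1 z = -1 /\ lam2 z = 1
       & perm_eq M ('Ind[W, klein u1] ('Res[klein u1] lam1) ::
                    'Ind[W, klein u2] ('Res[klein u2] lam2) :: N)]).
Proof.
have [k1 [l1 [_ def_k1 l1r _]]] : exists (k : Iirr W) (l : Iirr R),
    [/\ 'chi_k \isn't a linear_char, 'chi_k = 'Ind[W, R] 'chi_l, 'chi_l r = zeta ^+ 1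
      & is_rho m s t 1 k] by apply: rho_exists; lia.
rewrite expr1 in l1r.
have Ll (l : Iirr R) : 'chi_l \is a linear_char by apply: irr_cyclic_lin (cycle_cyclic r).
have l1_sqr x : x \in R -> 'chi_l1 x ^+ 2 = 1 -> (x ^+ 2 = 1)%g.
  by move=> xR; rewrite -lin_charX // => /(rot_char_faithful l1r); apply; rewrite groupX.
have [chi1 chi1M mult1] := model_constituent k1.
have perm1 := perm_to_rem chi1M.
have [u1 u1S [lam1 L1]] := model_member def_k1 chi1M mult1 l1_sqr.
case=> [def1|[m_even def1 lam1z]]; first by left; exists u1, lam1, (rem chi1 M); rewrite -def1.
have l1z : 'chi_l1 z = -1.
  (* The value is a sign, and it is not 1 because ['chi_l1] is faithful and [z] has order 2. *)
  apply/eqP; rewrite -[_ == _]negbK -rot_char_z //; apply/eqP.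
  move=> /(rot_char_faithful l1r in_R_z) z1.
  by have := order_z m_even; rewrite z1 order1.
rewrite l1z in lam1z.
(* If [m./2] were even, [lam1 z] would be an even power of a sign, hence 1. *)
have m2 : (m %% 4 = 2)%N.
  have m2_odd : odd m./2.
    apply/negPn/negP=> m2_even; have := signr_eqN1 false.
    rewrite -lam1z lin_z // -(even_halfK m2_even) -mul2n exprM [(_ * _) ^+ 2]exprMn.
    by rewrite !lin_sqr ?in_W_s ?in_W_t // mulr1 expr1n eqxx.
  by lia.
have [k2 [l2 [_ def_k2 l2r _]]] : exists (k : Iirr W) (l : Iirr R),
    [/\ 'chi_k \isn't a linear_char, 'chi_k = 'Ind[W, R] 'chi_l, 'chi_l r = zeta ^+ 2
      & is_rho m s t 2 k] by apply: rho_exists; lia.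
(* For [x = r ^+ i] the hypothesis says that [m] divides [4 * i]; as [m./2] is odd, [m] already
   divides [2 * i]. So the shape of members is available although ['chi_l2] is not faithful. *)
have l2_sqr x : x \in R -> 'chi_l2 x ^+ 2 = 1 -> (x ^+ 2 = 1)%g.
  case/cycleP=> i ->; rewrite lin_charX ?cycle_id // l2r -!(exprM zeta) => /eqP.
  rewrite -(prim_order_dvd prim_zeta) -expgM => dvd_m; apply/eqP.
  rewrite -order_dvdn order_r.
  have [n def_m n_odd] : exists2 n, m = (2 * n)%N & odd n by exists m./2; lia.
  have cop_n2 : coprime n 2 by rewrite coprimen2.
  move: dvd_m; rewrite def_m -mulnA !dvdn_pmul2l // (Gauss_dvdl _ cop_n2).
  by rewrite [(i * 2)%N]mulnC dvdn_pmul2l.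
have l2z : 'chi_l2 z = 1.
  rewrite lin_charX ?cycle_id // l2r -(exprM zeta) mul2n even_halfK //.
  exact: prim_expr_order prim_zeta.
right; split=> //.
have [chi2 chi2M mult2] := model_constituent k2.
(* The characters inducing [chi1] and ['chi_k2] differ at [z], so ['chi_k2] must come from a second
   member. *)
have mult12 : '[chi1, 'chi_k2] = 0.
  rewrite def1 def_k2 klein_mult_nonlin // lam1z l2z.
  by rewrite eq_sym (signr_eqN1 false).
have neq12 : chi2 != chi1 by apply: contraNneq mult2 => ->; rewrite mult12.
have chi2N : chi2 \in rem chi1 M.
  by have := chi2M; rewrite (perm_mem perm1) inE (negPf neq12).
have perm2 : perm_eq M (chi1 :: chi2 :: rem chi2 (rem chi1 M)).
  by apply: perm_trans perm1 _; rewrite perm_cons perm_to_rem.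
have [u2 u2S [lam2 L2]] := model_member def_k2 chi2M mult2 l2_sqr.
case=> [def2|[_ def2 lam2z]].
  (* A second member induced from a reflection would contain ['chi_k1] again. *)
  have := @model_mult_cat_le1 k1 [:: chi1; chi2] _ perm2.
  have k1_nonlin : 'chi_k1 \isn't a linear_char.
    by rewrite def_k1 qualifE /= Ind_rot1 // (eqr_nat _ 2 1) andbF.
  rewrite big_cons big_seq1 def2 refl_mult_nonlin // def1 def_k1 klein_mult_nonlin //.
  by rewrite lam1z l1z eqxx -(natrD _ 1 1) (ler_nat _ 2 1).
exists u1, u2, lam1, lam2, (rem chi2 (rem chi1 M)).
by rewrite -def1 -def2 lam1z lam2z l2z.
Qed.

End Model.

Section Completion.

Variable base : seq 'CF(W).
Hypothesis sumB : \sum_i 'chi_i =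
  \sum_(chi <- base) chi + \sum_(i in missing_linear (\sum_(chi <- base) chi)) 'chi_i.

Lemma missing_sub_lin (B : 'CF(W)) : missing_linear B \subset lin_irr.
Proof. by apply/subsetP=> i; rewrite !inE => /andP[]. Qed.

Lemma model_rest (M : {mset 'CF(W)}) (N : seq 'CF(W)) :
    qp_gelfand_model S M -> perm_eq M (base ++ N) ->
  (forall chi, chi \in N -> chi \is a character /\ chi != 0) /\
  \sum_(chi <- N) chi = \sum_(i in missing_linear (\sum_(chi <- base) chi)) 'chi_i.
Proof.
move=> modelM permM; split=> [chi chiN|].
  by apply: (model_char modelM); rewrite (perm_mem permM) mem_cat chiN orbT.
have [_ sumM] := modelM; move: sumM; rewrite (perm_big _ permM) big_cat /= sumB.
exact: addrI.
Qed.

Lemma model_completion (M : {mset 'CF(W)}) (N : seq 'CF(W)) :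
    #|missing_linear (\sum_(chi <- base) chi)| = 2%N ->
    qp_gelfand_model S M -> perm_eq M (base ++ N) ->
  append_two_missing base M.
Proof.
move=> card2 modelM permM; have [charN sumN] := model_rest modelM permM.
apply/append_two_missingP=> //.
have [b permN] := sum_eq_two_lin (missing_sub_lin _) card2 charN sumN.
exists b; rewrite -[M]seq_mset_id; apply/eq_seq_msetP.
by apply: perm_trans permM _; rewrite perm_cat2l.
Qed.

Lemma completion_model (M : {mset 'CF(W)}) :
    (forall chi, chi \in base -> allowed_char S chi) ->
    #|missing_linear (\sum_(chi <- base) chi)| = 2%N ->
  append_two_missing base M -> qp_gelfand_model S M.
Proof.
move=> allB card2 /(append_two_missingP _ card2)[b ->].
have sumD := sumB; set D := missing_linear _ in card2 sumD.
have sDL : D \subset lin_irr := missing_sub_lin _.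
have defM := perm_eq_seq_mset (completion base b).
split=> [chi|]; last first.
  rewrite (perm_big _ defM) big_cat /= sumD; congr (_ + _).
  by case: b {defM}; rewrite ?big_seq1 // big_map big_enum.
have -> : (chi \in seq_mset (completion base b)) = (chi \in completion base b).
  exact: (perm_mem defM).
rewrite mem_cat => /orP[/allB//|]; rewrite -/D; case: b {defM} => [|].
  case/mapP=> i; rewrite mem_enum => /(subsetP sDL); rewrite inE => Li ->.
  exact: allowed_lin.
rewrite inE => /eqP->; have /cards2P[i [j [neq defD]]] : #|D| == 2%N by apply/eqP.
have [Li Lj] : i \in lin_irr /\ j \in lin_irr.
  by split; apply: (subsetP sDL); rewrite defD ?set21 ?set22.
by rewrite defD big_setU1 ?inE // big_set1; have [] := joined_lin Li Lj neq.
Qed.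

Lemma filter_completion (b : bool) :
    #|missing_linear (\sum_(chi <- base) chi)| \in [:: 1%N; 2%N] ->
    (forall chi : 'CF(W), chi \in base -> 2 < chi 1%g) ->
  [seq chi <- completion base b | 2 < (chi : 'CF(W)) 1%g] = base.
Proof.
set D := missing_linear _ => cardD degB; have sDL : D \subset lin_irr := missing_sub_lin _.
rewrite filter_cat (all_filterP _); last by apply/allP=> chi /degB.
rewrite -[RHS]cats0; congr (_ ++ _); apply/eqP; rewrite -/D -(negbK (_ == _)) -has_filter.
apply/hasPn=> chi; case: b => [/mapP[i]|].
  rewrite mem_enum => /(subsetP sDL); rewrite inE => Li ->.
  by rewrite lin_char1 // (ltr_nat _ 2 1).
rewrite inE => /eqP->; rewrite deg_missing // (ltr_nat _ 2).
by move: cardD; rewrite !inE => /orP[]/eqP->.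
Qed.

End Completion.

Lemma reflection_inducedP (chi : 'CF(W)) : reflection_induced s t chi <->
  exists (u : gT) (lam : 'CF(W)),
    [/\ u \in S, lam \is a linear_char & chi = 'Ind[W, <[u]>] ('Res[<[u]>] lam)].
Proof.
split=> [[u [xi [uS Lxi xi_u ->]]] | [u [lam [uS Llam ->]]]].
  exists u; have [c xi_c] : exists c : bool, xi u = (-1) ^+ c.
    by case: xi_u => ->; [exists false | exists true].
  have [lam Llam lam_u] := lin_extend c uS; exists lam; split=> //; congr ('Ind[W] _).
  apply/cfun_inP=> x xu; rewrite cfResE ?refl_subW //; case/cycleP: xu => i ->.
  by rewrite !lin_charX ?cycle_id ?(letterW uS) // lam_u xi_c.
exists u, ('Res[<[u]>] lam); split=> //; first exact: cfRes_lin_char.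
rewrite cfResE ?refl_subW ?cycle_id //; have [b ->] := lin_pm1 Llam (letterW uS).
by case: b; [right | left].
Qed.

Lemma zeta_half : ~~ odd m -> zeta ^+ m./2 = -1.
Proof. by move=> m_even; rewrite -exprM mul2n even_halfK // rootCK //; lia. Qed.

Lemma klein_contains_rho (lam : 'CF(W)) (h : nat) : ~~ odd m -> lam \is a linear_char ->
    (0 < h)%N -> (2 * h < m)%N -> lam z = (-1) ^+ h ->
  contains_rho m s t ('Ind[W, klein s] ('Res[klein s] lam)) h.
Proof.
move=> m_even Llam h_gt0 lt_h lam_z.
have [k [l [_ def_k l_r rho_k]]] := rho_exists h_gt0 lt_h.
have Ll : 'chi_l \is a linear_char by apply: irr_cyclic_lin (cycle_cyclic r).
exists k => //; rewrite irr_consttE def_k klein_mult_nonlin ?set21 //.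
(* The inducing character of [R] has value [zeta ^+ (h * m./2) = (-1) ^+ h] at [z]. *)
rewrite lam_z lin_charX ?cycle_id // l_r -(exprM zeta) mulnC exprM zeta_half // eqxx.
exact: oner_neq0.
Qed.

Lemma klein_contains_lambda (lam : 'CF(W)) (a b : algC) : (m %% 4 = 2)%N ->
    lam \is a linear_char ->
  contains_lambda s t ('Ind[W, klein s] ('Res[klein s] lam)) a b <-> lam s = a /\ lam t = b.
Proof.
move=> m2 Llam; have m_even : ~~ odd m by lia.
split=> [[i [Li <- <-]] | [lam_s lam_t]].
  by rewrite irr_consttE klein_mult_lin ?set21 // pnatr_eq0 eqb0 negbK => /eqP->.
have /irrP[i def_i] := lin_char_irr Llam; exists i; first by rewrite /is_lambda -def_i.
by rewrite irr_consttE -def_i klein_mult_lin ?set21 // eqxx oner_neq0.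
Qed.

(** The linear character contained in a member is [lam] itself, and its signs give [lam z].
    Conversely, the sign at [z] decides the parity of the [rho_h] that occur and whether the signs
    on [s] and [t] agree. *)
Lemma extra_modelP (M : {mset 'CF(W)}) : (m %% 4 = 2)%N -> extra_model m s t M <->
  exists lam1 lam2 : 'CF(W), [/\ lam1 \is a linear_char, lam2 \is a linear_char,
    lam1 z = -1, lam2 z = 1 &
    append_two_missing [:: 'Ind[W, klein s] ('Res[klein s] lam1);
      'Ind[W, klein s] ('Res[klein s] lam2)] M].
Proof.
move=> m2; have m_even : ~~ odd m by lia.
split.
  case=> chi1 [chi2 [[[lam1 L1 ->] [lam2 L2 ->]] _ c1 _ [c2 defM]]].
  exists lam1, lam2; split=> //; rewrite lin_z_mod4 //.
    case: c1 => /(klein_contains_lambda _ _ m2 L1)[-> ->]; by rewrite ?mulr1 ?mul1r.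
  case: c2 => /(klein_contains_lambda _ _ m2 L2)[-> ->]; by rewrite ?mulrNN mulr1.
case=> lam1 [lam2 [L1 L2 lam1z lam2z defM]].
exists ('Ind[W, klein s] ('Res[klein s] lam1)), ('Ind[W, klein s] ('Res[klein s] lam2)).
split=> //.
- by split; [exists lam1 | exists lam2].
- move=> h h_gt0 lt_h h_odd; apply: klein_contains_rho => //.
  by rewrite -signr_odd h_odd lam1z.
- have := lam1z; rewrite lin_z_mod4 //.
  have [a s1] := lin_pm1 L1 in_W_s; have [b t1] := lin_pm1 L1 in_W_t.
  rewrite s1 t1 -signr_addb => /eqP; rewrite signr_eqN1 => ab.
  case: a b s1 t1 ab => [] [] //= s1 t1 _; [right | left];
    by apply/(klein_contains_lambda _ _ m2 L1); rewrite s1 t1.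
- move=> h h_gt0 lt_h h_even; apply: klein_contains_rho => //.
  by rewrite -signr_odd (negPf h_even) lam2z.
split=> //; have := lam2z; rewrite lin_z_mod4 //.
have [a s2'] := lin_pm1 L2 in_W_s; have [b t2'] := lin_pm1 L2 in_W_t.
rewrite s2' t2' -signr_addb => ab.
have {}ab : (a (+) b) = false.
  case def_ab: (a (+) b) => //; move: ab; rewrite def_ab expr1 => /eqP.
  by rewrite eq_sym (signr_eqN1 false).
case: a b s2' t2' ab => [] [] //= s2' t2' _; [right | left];
  by apply/(klein_contains_lambda _ _ m2 L2); rewrite s2' t2'.
Qed.

Lemma klein_pair_complement (lam1 lam2 : 'CF(W))
    (base := [:: 'Ind[W, klein s] ('Res[klein s] lam1);
                 'Ind[W, klein s] ('Res[klein s] lam2)]) :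
    (m %% 4 = 2)%N -> lam1 \is a linear_char -> lam2 \is a linear_char ->
    lam1 z = -1 -> lam2 z = 1 ->
  \sum_i 'chi_i =
    \sum_(chi <- base) chi + \sum_(i in missing_linear (\sum_(chi <- base) chi)) 'chi_i /\
  #|missing_linear (\sum_(chi <- base) chi)| = 2%N.
Proof.
move=> m2 L1 L2 lam1z lam2z; have m_even : ~~ odd m by lia.
rewrite /base big_cons big_seq1.
have := klein_complement m2 (set21 s t) (set21 s t) L1 L2 lam1z lam2z.
by rewrite gcdm2 (negPf m_even).
Qed.

Lemma refl_single_complement (u : gT) (lam : 'CF(W))
    (base := [:: 'Ind[W, <[u]>] ('Res[<[u]>] lam)]) :
    u \in S -> lam \is a linear_char ->
  \sum_i 'chi_i =
    \sum_(chi <- base) chi + \sum_(i in missing_linear (\sum_(chi <- base) chi)) 'chi_i /\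
  #|missing_linear (\sum_(chi <- base) chi)| = if odd m then 1%N else 2.
Proof.
by move=> uS Llam; rewrite /base big_seq1 -gcdm2; apply: refl_complement.
Qed.

Lemma even_modelP (M : {mset 'CF(W)}) : ~~ odd m ->
  qp_gelfand_model S M <-> even_model s t M \/ (m %% 4 = 2)%N /\ extra_model m s t M.
Proof.
move=> m_even; split=> [modelM|[[chi /reflection_inducedP[u [lam [uS Llam ->]]]]|[m2]]].
- have [[u [lam [N [uS Llam permM]]]]|[m2]] := model_cases modelM.
    left; exists ('Ind[W, <[u]>] ('Res[<[u]>] lam)).
      by apply/reflection_inducedP; exists u, lam.
    have [sumB cardB] := refl_single_complement uS Llam; rewrite (negPf m_even) in cardB.
    exact: (@model_completion _ sumB M N).
  case=> u1 [u2 [lam1 [lam2 [N [[u1S u2S] L1 L2 [lam1z lam2z] permM]]]]].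
  (* [extra_model] is formulated with [<z, s>], and [<z, t>] induces the same characters. *)
  rewrite (klein_indep m2 u1S L1) (klein_indep m2 u2S L2) in permM.
  right; split=> //; apply/extra_modelP => //; exists lam1, lam2; split=> //.
  have [sumB cardB] := klein_pair_complement m2 L1 L2 lam1z lam2z.
  exact: (@model_completion _ sumB M N).
- have [sumB cardB] := refl_single_complement uS Llam; rewrite (negPf m_even) in cardB.
  apply: completion_model => // chi'; rewrite inE => /eqP->.
  by apply: (@allowed_Ind_letter u); rewrite ?refl_subW ?cycle_id.
case/extra_modelP=> // lam1 [lam2 [L1 L2 lam1z lam2z]].
have [sumB cardB] := klein_pair_complement m2 L1 L2 lam1z lam2z.
apply: completion_model => // chi'; rewrite !inE => /orP[]/eqP->.
  by apply: (@allowed_Ind_letter s); rewrite ?klein_subW ?klein_u ?set21.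
by apply: (@allowed_Ind_letter s); rewrite ?klein_subW ?klein_u ?set21.
Qed.

(** For odd [m] the multiplicities agree, since every linear character takes the same value at [s]
    and [t]. *)
Lemma refl_indep_odd (u : gT) (lam : 'CF(W)) : odd m -> u \in S -> lam \is a linear_char ->
  'Ind[W, <[u]>] ('Res[<[u]>] lam) = 'Ind[W, <[s]>] ('Res[<[s]>] lam).
Proof.
move=> m_odd uS Llam; rewrite [LHS]cfun_sum_cfdot [RHS]cfun_sum_cfdot.
apply: eq_bigr => k _; congr (_ *: _).
have [Lk|Lk] := boolP ('chi_k \is a linear_char); last by rewrite !refl_mult_nonlin ?set21.
rewrite !refl_mult_lin ?set21 //.
by case/set2P: uS => -> //; rewrite !(lin_odd m_odd).
Qed.

Lemma sgn_or_one (lam : 'CF(W)) : odd m -> lam \is a linear_char ->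
  lam = 1 \/ is_sgn s t lam.
Proof.
move=> m_odd Llam; have [[] lam_s] := lin_pm1 Llam in_W_s; [right | left].
  by split; rewrite -?(lin_odd m_odd).
by apply: lin_eq; rewrite ?cfun1_lin_char ?cfun1E ?in_W_s ?in_W_t -?(lin_odd m_odd Llam).
Qed.

Lemma odd_base_lin (sigma : 'CF(W)) : sigma = 1 \/ is_sgn s t sigma ->
  sigma \is a linear_char.
Proof. by case=> [->|[]//]; apply: cfun1_lin_char. Qed.

Lemma odd_modelP (M : {mset 'CF(W)}) : odd m ->
  qp_gelfand_model S M <-> odd_model s t M.
Proof.
move=> m_odd; split=> [modelM|[sigma [i [/odd_base_lin Ls defD ->]]]].
  have [[u [lam [N [uS Llam permM]]]]|[m2]] := model_cases modelM; last by lia.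
  have [sumB cardB] := refl_single_complement uS Llam; rewrite m_odd in cardB.
  have [charN sumN] := model_rest sumB modelM permM.
  move/eqP/cards1P: cardB => [i defD].
  have Li : i \in lin_irr.
    by have := set11 i; rewrite -defD; apply: (subsetP (missing_sub_lin _)).
  rewrite defD big_set1 in sumN; rewrite big_seq1 in defD.
  exists lam, i; split; first exact: sgn_or_one.
    by rewrite -(refl_indep_odd m_odd uS).
  rewrite -[M]seq_mset_id; apply/eq_seq_msetP; rewrite -(refl_indep_odd m_odd uS) //.
  by rewrite (sum_eq_one_lin Li charN sumN) in permM.
have [sumB cardB] := refl_single_complement (set21 s t) Ls.
set chi := 'Ind[W, _] _ in defD sumB cardB *.
rewrite big_seq1 defD big_set1 in sumB.
have defM := perm_eq_seq_mset [:: chi; 'chi_i].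
split=> [psi|]; last by rewrite (perm_big _ defM) big_cons big_seq1 /= -sumB.
have -> : (psi \in seq_mset [:: chi; 'chi_i]) = (psi \in [:: chi; 'chi_i]).
  exact: (perm_mem defM).
rewrite !inE => /orP[]/eqP->.
  by apply: (@allowed_Ind_letter s); rewrite ?refl_subW ?cycle_id ?set21.
apply: allowed_lin; have : i \in missing_linear chi by rewrite defD set11.
by rewrite inE => /andP[].
Qed.

(** For admissible signs the default index [0] is never reached. *)
Definition lin_pick (a b : bool) : Iirr W :=
  odflt 0 [pick i in lin_irr | lin_sign i == (a, b)].

Lemma lin_pickP (a b : bool) : ~~ odd m || (a == b) ->
  [/\ 'chi_(lin_pick a b) \is a linear_char, 'chi_(lin_pick a b) s = (-1) ^+ a
    & 'chi_(lin_pick a b) t = (-1) ^+ b].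
Proof.
move=> ab; rewrite /lin_pick; case: pickP => [i /andP[Li /eqP def_i]|none] /=.
  have [-> ->] := lin_signE Li; rewrite def_i; split=> //.
  by move: Li; rewrite inE.
have [i Li [is_ it_]] := lin_exists ab.
by have := none i; rewrite Li /lin_sign is_ it_ !signr_eqN1 eqxx.
Qed.

(** Only the sign at [u] matters; the pair [(c, c)] is admissible for both parities of [m]. *)
Definition refl_char (u : gT) (c : bool) : 'CF(W) :=
  'Ind[W, <[u]>] ('Res[<[u]>] 'chi_(lin_pick c c)).

Lemma lin_pick_diag (c : bool) (u : gT) : u \in S ->
  'chi_(lin_pick c c) \is a linear_char /\ 'chi_(lin_pick c c) u = (-1) ^+ c.
Proof.
have [|L ls lt] := @lin_pickP c c; first by rewrite eqxx orbT.
by case/set2P=> ->.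
Qed.

Lemma refl_charE (u : gT) (lam : 'CF(W)) (c : bool) : u \in S -> lam \is a linear_char ->
  lam u = (-1) ^+ c -> 'Ind[W, <[u]>] ('Res[<[u]>] lam) = refl_char u c.
Proof.
move=> uS Llam lam_u; congr ('Ind[W] _); have [Lp p_u] := lin_pick_diag c uS.
apply/cfun_inP=> x xu; rewrite !cfResE ?refl_subW //; case/cycleP: xu => i ->.
by rewrite !lin_charX ?(letterW uS) // lam_u p_u.
Qed.

Lemma t_neq_s : (t == s) = false.
Proof. by apply/eqP=> ts; have := order_r; rewrite ts mulss order1; lia. Qed.

Lemma refl_char_mult (u : gT) (c a b : bool) : u \in S -> ~~ odd m || (a == b) ->
  '[refl_char u c, 'chi_(lin_pick a b)] = (c == if u == s then a else b)%:R.
Proof.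
move=> uS ab; have [Lp p_u] := lin_pick_diag c uS; have [Lab abs abt] := lin_pickP ab.
rewrite refl_mult_lin // p_u; congr (nat_of_bool _)%:R.
case/set2P: uS => def_u; rewrite def_u ?eqxx ?t_neq_s ?abs ?abt;
  by rewrite (inj_eq signr_inj).
Qed.

Definition refl_chars : seq 'CF(W) :=
  [:: refl_char s false; refl_char s true; refl_char t false; refl_char t true].

(** Each two of the four are separated by a linear character, with signs [(a, b)], that occurs in
    only one of them. *)
Lemma refl_chars_uniq : ~~ odd m -> uniq refl_chars.
Proof.
move=> m_even; have mult u c a b (uS : u \in S) : '[refl_char u c, 'chi_(lin_pick a b)] =
    (c == if u == s then a else b)%:R by rewrite refl_char_mult ?m_even.
have sep u c u' c' (a b : bool) : u \in S -> u' \in S ->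
    (c == if u == s then a else b) != (c' == if u' == s then a else b) ->
    (refl_char u c == refl_char u' c') = false.
  move=> uS u'S; apply: contraNF => /eqP eqc.
  have := congr1 (fun f => '[f, 'chi_(lin_pick a b)]) eqc; rewrite /= !mult //.
  by move/eqP; rewrite eqr_nat; case: (c == _); case: (c' == _).
rewrite /= !inE (sep s false s true false false) ?(sep s false t false false true)
  ?(sep s false t true false false) ?(sep s true t false false false)
  ?(sep s true t true true false) ?(sep t false t true false false);
  by rewrite ?set21 ?set22 ?eqxx ?t_neq_s.
Qed.

Lemma reflection_induced_chars (chi : 'CF(W)) :
  reflection_induced s t chi <-> chi \in refl_chars.
Proof.
rewrite reflection_inducedP; split=> [[u [lam [uS Llam ->]]]|].
  have [c lam_u] := lin_pm1 Llam (letterW uS); rewrite (refl_charE uS Llam lam_u) !inE.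
  by case/set2P: uS => ->; case: c {lam_u}; rewrite eqxx ?orbT.
have ex u c : u \in S -> chi = refl_char u c -> exists (u : gT) (lam : 'CF(W)),
    [/\ u \in S, lam \is a linear_char & chi = 'Ind[W, <[u]>] ('Res[<[u]>] lam)].
  by move=> uS ->; have [Lp _] := lin_pick_diag c uS; exists u, 'chi_(lin_pick c c).
by rewrite !inE => /or4P[]/eqP; apply: ex; rewrite ?set21 ?set22.
Qed.

(** * Counting the models *)

(* The degree bound 2 separates the base of a model from the linear characters,
   split or joined, appended to it. *)
Definition large_chars (M : seq 'CF(W)) : seq 'CF(W) :=
  [seq chi <- M | 2 < (chi : 'CF(W)) 1%g].

Section Family.

Variables (BL : seq (seq 'CF(W))) (P : {mset 'CF(W)} -> Prop).
Hypothesis uniqBL : uniq BL.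
Hypothesis permBL : {in BL &, forall B B', perm_eq B B' -> B = B'}.
Hypothesis degBL : forall B (chi : 'CF(W)), B \in BL -> chi \in B -> 2 < chi 1%g.
Hypothesis cardBL : forall B, B \in BL -> #|missing_linear (\sum_(chi <- B) chi)| = 2%N.
Hypothesis P_BL : forall M, P M <-> exists2 B, B \in BL & append_two_missing B M.

Lemma large_completion (B : seq 'CF(W)) (b : bool) : B \in BL ->
  large_chars (completion B b) = B.
Proof.
move=> BB; apply: filter_completion; first by rewrite cardBL.
by move=> chi; apply: degBL.
Qed.

Lemma family_large (M : {mset 'CF(W)}) : P M ->
  exists2 B, B \in BL & perm_eq (large_chars M) B.
Proof.
case/P_BL=> B BB /(append_two_missingP _ (cardBL BB))[b ->]; exists B => //.
by rewrite -[X in perm_eq _ X](large_completion b BB) perm_filter // perm_eq_seq_mset.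
Qed.

(** A model determines its base through its members of large degree, and each base has two
    completions. *)
Lemma family_has_exactly : has_exactly (2 * size BL) P.
Proof.
exists [seq seq_mset (completion B b) | B <- BL, b <- [:: true; false]]; split.
- apply: allpairs_uniq => // p p' /allpairsP[[C c] [CB _ ->]] /allpairsP[[C' c'] [CB' _ ->]].
  move: CB CB' => /= CB CB' /eq_seq_msetP permC.
  have eqC : C = C'.
    apply: permBL => //; rewrite -(large_completion c CB) -(large_completion c' CB').
    exact: perm_filter.
  (* The split completion has one more term than the joined one, so the sizes determine the flag. *)
  have := perm_size permC; rewrite -eqC !size_cat => /addnI.
  by case: c {permC}; case: c' => //=; rewrite size_map -cardE cardBL.
- by rewrite size_allpairs mulnC.
move=> M; split=> [/P_BL[B BB /(append_two_missingP _ (cardBL BB))[b ->]]|].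
  by apply/allpairsP; exists (B, b); split=> //; case: b.
case/allpairsP=> -[B b] /= [BB _ ->]; apply/P_BL; exists B => //.
by apply/append_two_missingP; [apply: cardBL | exists b].
Qed.

End Family.

Lemma refl_char_deg (u : gT) (c : bool) : u \in S -> 2 < refl_char u c 1%g.
Proof. by move=> uS; have [Lp _] := lin_pick_diag c uS; rewrite refl_deg // ltr_nat. Qed.

Definition even_bases : seq (seq 'CF(W)) := [seq [:: chi] | chi <- refl_chars].

Lemma even_bases_deg B (chi : 'CF(W)) : B \in even_bases -> chi \in B -> 2 < chi 1%g.
Proof.
case/mapP=> c cR ->; rewrite inE => /eqP->.
by move: cR; rewrite !inE => /or4P[]/eqP->; rewrite refl_char_deg ?set21 ?set22.
Qed.

Lemma even_bases_card B : ~~ odd m -> B \in even_bases ->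
  #|missing_linear (\sum_(chi <- B) chi)| = 2%N.
Proof.
move=> m_even /mapP[c /reflection_induced_chars/reflection_inducedP[u [lam [uS Llam ->]]] ->].
by have [_ ->] := refl_single_complement uS Llam; rewrite (negPf m_even).
Qed.

Lemma even_bases_model (M : {mset 'CF(W)}) :
  even_model s t M <-> exists2 B, B \in even_bases & append_two_missing B M.
Proof.
split=> [[chi /reflection_induced_chars chiR defM]|[_ /mapP[chi chiR ->] defM]].
  by exists [:: chi] => //; apply: map_f.
by exists chi => //; apply/reflection_induced_chars.
Qed.

Lemma even_model_has_exactly : ~~ odd m -> has_exactly 8 (even_model (W := W) s t).
Proof.
move=> m_even; apply: (@family_has_exactly even_bases).
- by rewrite map_inj_uniq ?refl_chars_uniq // => x y [].
- move=> _ _ /mapP[x _ ->] /mapP[y _ ->] /perm_mem/(_ x).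
  by rewrite !inE eqxx => /esym/eqP->.
- exact: even_bases_deg.
- by move=> B; apply: even_bases_card.
- exact: even_bases_model.
Qed.

Lemma reflection_induced_has_exactly : ~~ odd m ->
  has_exactly 4 (reflection_induced (W := W) s t).
Proof.
move=> m_even; exists refl_chars; split=> //; first exact: refl_chars_uniq.
exact: reflection_induced_chars.
Qed.

(** A single linear character is missing, so there is no choice in the completion; the two bases are
    told apart by a linear character. *)
Lemma odd_model_has_exactly : odd m -> has_exactly 2 (odd_model (W := W) s t).
Proof.
move=> m_odd; pose F c := completion [:: refl_char s c] true.
have sS : s \in S := set21 s t.
have card1 c : #|missing_linear (\sum_(chi <- [:: refl_char s c]) chi)| = 1%N.
  have [Lp _] := lin_pick_diag c sS.
  by have [_ ->] := refl_single_complement sS Lp; rewrite m_odd.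
have largeF c : large_chars (F c) = [:: refl_char s c].
  apply: filter_completion; first by rewrite card1.
  by move=> chi; rewrite inE => /eqP->; apply: refl_char_deg.
exists [seq seq_mset (F c) | c <- [:: true; false]]; split=> //.
  rewrite map_inj_uniq // => c c' /eq_seq_msetP permF.
  have : perm_eq (large_chars (F c)) (large_chars (F c')) by apply: perm_filter.
  rewrite !largeF => /perm_mem/(_ (refl_char s c)); rewrite !inE eqxx => /esym/eqP eqc.
  have := congr1 (fun f => '[f, 'chi_(lin_pick c c)]) eqc.
  rewrite /= !refl_char_mult ?eqxx ?orbT // => /eqP; rewrite eqr_nat.
  by case: (c' =P c) => // ->.
move=> M; split=> [[sigma [i [/odd_base_lin Ls defD ->]]]|].
  have [c sigma_s] := lin_pm1 Ls in_W_s.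
  apply/mapP; exists c; first by case: c {sigma_s}.
  rewrite (refl_charE sS Ls sigma_s) in defD *.
  by rewrite /F /completion big_seq1 defD enum_set1.
case/mapP=> c _ ->; have [Lp _] := lin_pick_diag c sS.
exists 'chi_(lin_pick c c); have := card1 c; rewrite big_seq1 => /eqP/cards1P[i defD].
exists i; split=> //; first exact: sgn_or_one.
by rewrite /F /completion big_seq1 defD enum_set1.
Qed.

(** * The additional models for [m = 2 mod 4] *)

Section Extra.

Hypothesis m2 : (m %% 4 = 2)%N.

Definition klein_char (a b : bool) : 'CF(W) :=
  'Ind[W, klein s] ('Res[klein s] 'chi_(lin_pick a b)).

Let m_even : ~~ odd m. Proof. by lia. Qed.

(** The only linear constituent of [klein_char a b] is the one with signs [(a, b)]. *)
Lemma klein_char_inj (a b a' b' : bool) :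
  (klein_char a b == klein_char a' b') = ((a, b) == (a', b')).
Proof.
have [|L ls lt] := @lin_pickP a b; first by rewrite m_even.
have [|L' ls' lt'] := @lin_pickP a' b'; first by rewrite m_even.
apply/eqP/eqP=> [eqK | [-> ->] //].
have := congr1 (fun f => '[f, 'chi_(lin_pick a b)]) eqK.
rewrite /= !klein_mult_lin ?set21 // eqxx => /eqP; rewrite eqr_nat.
case: ('chi_(lin_pick a' b') =P 'chi_(lin_pick a b)) => // eqL _.
move: ls lt; rewrite -eqL ls' lt'.
by move=> /signr_inj-> /signr_inj->.
Qed.

(** Unequal signs mean the value [-1] at [z], equal signs the value [1]. *)
Definition extra_bases : seq (seq 'CF(W)) :=
  [seq [:: chi1; chi2] | chi1 <- [:: klein_char false true; klein_char true false],
                         chi2 <- [:: klein_char false false; klein_char true true]].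

Lemma lin_klein_char (lam : 'CF(W)) : lam \is a linear_char ->
  exists a b, [/\ lam = 'chi_(lin_pick a b), lam s = (-1) ^+ a & lam t = (-1) ^+ b].
Proof.
move=> Llam; have [a lam_s] := lin_pm1 Llam in_W_s; have [b lam_t] := lin_pm1 Llam in_W_t.
have [|L ls lt] := @lin_pickP a b; first by rewrite m_even.
by exists a, b; split=> //; apply: lin_eq; rewrite ?ls ?lt.
Qed.

Lemma extra_bases_model (M : {mset 'CF(W)}) :
  extra_model m s t M <-> exists2 B, B \in extra_bases & append_two_missing B M.
Proof.
have pickz a b : 'chi_(lin_pick a b) z = (-1) ^+ (a (+) b).
  have [|L ls lt] := @lin_pickP a b; first by rewrite m_even.
  by rewrite lin_z_mod4 // ls lt signr_addb.
have Lpick a b : 'chi_(lin_pick a b) \is a linear_char.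
  by have [|] := @lin_pickP a b; first by rewrite m_even.
rewrite extra_modelP //; split=> [[lam1 [lam2 [L1 L2]]]|[B]].
  have [a [b [-> _ _]]] := lin_klein_char L1; have [c [d [-> _ _]]] := lin_klein_char L2.
  rewrite !pickz => /eqP; rewrite signr_eqN1 => ab cd defM.
  have {}cd : c (+) d = false.
    case def_cd: (c (+) d) => //; move: cd; rewrite def_cd expr1 => /eqP.
    by rewrite eq_sym (signr_eqN1 false).
  exists [:: klein_char a b; klein_char c d] => //.
  apply/allpairsP; exists (klein_char a b, klein_char c d); split=> //=.
    by case: a b ab {defM} => [] [] //= _; rewrite !inE eqxx ?orbT.
  by case: c d cd {defM} => [] [] //= _; rewrite !inE eqxx ?orbT.
case/allpairsP=> -[x y] /= [xA yB ->] defM.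
have [a [b [def_x ab]]] : exists a b, x = klein_char a b /\ a (+) b = true.
  by move: xA; rewrite !inE => /orP[]/eqP->; [exists false, true | exists true, false].
have [c [d [def_y cd]]] : exists c d, y = klein_char c d /\ c (+) d = false.
  by move: yB; rewrite !inE => /orP[]/eqP->; [exists false, false | exists true, true].
exists 'chi_(lin_pick a b), 'chi_(lin_pick c d).
by rewrite !pickz ab cd -/(klein_char a b) -/(klein_char c d) -def_x -def_y.
Qed.

Lemma extra_bases_deg B (chi : 'CF(W)) : B \in extra_bases -> chi \in B -> 2 < chi 1%g.
Proof.
have deg a b : 2 < klein_char a b 1%g.
  have [|L _ _] := @lin_pickP a b; first by rewrite m_even.
  (* The degree is [m./2], which is at least 3 because [m >= 3] and [m = 2 mod 4] give [m >= 6]. *)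
  by rewrite klein_deg ?set21 // (ltr_nat _ 2); lia.
case/allpairsP=> -[x y] /= [xA yB ->]; rewrite !inE.
by case/orP=> /eqP->; [move: xA | move: yB]; rewrite !inE => /orP[]/eqP->.
Qed.

Lemma extra_bases_card B : B \in extra_bases ->
  #|missing_linear (\sum_(chi <- B) chi)| = 2%N.
Proof.
have card a b c d : a (+) b = true -> c (+) d = false ->
    #|missing_linear (\sum_(chi <- [:: klein_char a b; klein_char c d]) chi)| = 2%N.
  move=> ab cd; have [|L1 s1 t1] := @lin_pickP a b; first by rewrite m_even.
  have [|L2 s2' t2'] := @lin_pickP c d; first by rewrite m_even.
  by have [||_ ->] := klein_pair_complement m2 L1 L2;
    rewrite ?lin_z_mod4 // ?s1 ?t1 ?s2' ?t2' -signr_addb ?ab ?cd.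
by case/allpairsP=> -[x y] /= [xA yB ->]; move: xA yB; rewrite !inE;
  case/orP=> /eqP->; case/orP=> /eqP->; apply: card.
Qed.

(** First and second entries come from disjoint lists, so a permutation cannot exchange them. *)
Lemma extra_bases_perm : {in extra_bases &, forall B B', perm_eq B B' -> B = B'}.
Proof.
move=> _ _ /allpairsP[[x y] /= [xA yB ->]] /allpairsP[[x' y'] /= [xA' yB' ->]].
have AB u v : u \in [:: klein_char false true; klein_char true false] ->
    v \in [:: klein_char false false; klein_char true true] -> (u == v) = false.
  by rewrite !inE => /orP[]/eqP-> /orP[]/eqP->; rewrite klein_char_inj.
move=> permB; have := perm_mem permB x; rewrite !inE eqxx (AB x y') // orbF => /esym/eqP eqx.
have := perm_mem permB y; rewrite !inE eqxx orbT [y == x']eq_sym (AB x' y) //=.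
by rewrite eqx => /esym/eqP->.
Qed.

Lemma extra_model_has_exactly : has_exactly 8 (extra_model m (W := W) s t).
Proof.
apply: (@family_has_exactly extra_bases).
- apply: allpairs_uniq; rewrite /= ?inE ?klein_char_inj //.
  by move=> [x y] [x' y'] _ _ [-> ->].
- exact: extra_bases_perm.
- exact: extra_bases_deg.
- exact: extra_bases_card.
- exact: extra_bases_model.
Qed.

(** A model of the first kind has two members of degree above 2, one of the second kind only one. *)
Lemma extra_not_even (M : {mset 'CF(W)}) : extra_model m s t M -> ~ even_model s t M.
Proof.
case/(family_large extra_bases_deg extra_bases_card extra_bases_model)=> B BE permB.
case/(family_large even_bases_deg (fun B => @even_bases_card B m_even) even_bases_model).
move=> B' BE' permB'; have := perm_size permB'; rewrite (perm_size permB).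
by case/allpairsP: BE => -[x y] [_ _ ->]; case/mapP: BE' => c _ ->.
Qed.

End Extra.

End DihedralGroup.

(** * Combining the counts, and the order of the presented group *)

Lemma has_exactly_iff (K : eqType) (n : nat) (P Q : K -> Prop) :
  (forall x, P x <-> Q x) -> has_exactly n P -> has_exactly n Q.
Proof.
move=> PQ [L [uL szL PL]]; exists L; split=> // x.
by split=> [/PQ/PL//|/PL/PQ].
Qed.

Lemma has_exactly_or (K : eqType) (n k : nat) (P Q : K -> Prop) :
    has_exactly n P -> has_exactly k Q -> (forall x, Q x -> ~ P x) ->
  has_exactly (n + k) (fun x => P x \/ Q x).
Proof.
move=> [L1 [u1 sz1 P1]] [L2 [u2 sz2 P2]] disj; exists (L1 ++ L2); split=> [||x].
- rewrite cat_uniq u1 u2 andbT; apply/hasPn=> x /P2/disj nPx.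
  by apply/negP=> /P1.
- by rewrite size_cat sz1 sz2.
rewrite mem_cat; split=> [[/P1->//|/P2->]|/orP[/P1|/P2]]; [|left|right] => //.
by rewrite orbT.
Qed.

(** [W] and ['D_m.*2] have the same presentation, so each is a homomorphic image of the other. *)
Lemma dihedral_presentation_card (m : nat) (gT : finGroupType) (W : {group gT}) (s t : gT) :
  (1 < m)%N -> dihedral_presentation m W s t -> #|W| = (2 * m)%N.
Proof.
move=> m_gt1 [isoW _ _ _ _]; have isoD := Grp'_dihedral m_gt1.
have homWD : (W \homg 'D_m.*2)%g by rewrite isoD; apply: isoGrp_hom.
have homDW : ('D_m.*2 \homg W)%g by rewrite isoW; apply: isoGrp_hom.
have isoWD : (W \isog 'D_m.*2)%g by rewrite isogEhom homWD homDW.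
by rewrite (card_isog isoWD) card_dihedral // mul2n.
Qed.

Theorem theorem6p1 (m : nat) (gT : finGroupType) (W : {group gT}) (s t : gT)
    (hm : (3 <= m)%N) (hW : dihedral_presentation m W s t) :
  [/\ odd m ->
        (forall M : {mset 'CF(W)},
           qp_gelfand_model [set s; t] M <-> odd_model s t M) /\
        has_exactly 2 (odd_model (W := W) s t),
      ~~ odd m ->
        [/\ forall M : {mset 'CF(W)},
              qp_gelfand_model [set s; t] M <->
              even_model s t M \/ (m %% 4 = 2)%N /\ extra_model m s t M,
            has_exactly 4 (reflection_induced (W := W) s t)
          & has_exactly 8 (even_model (W := W) s t)],
      (m %% 4 = 2)%N ->
        has_exactly 8 (extra_model m (W := W) s t) /\
        (forall M : {mset 'CF(W)}, extra_model m s t M -> ~ even_model s t M)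
    & [/\ odd m -> has_exactly 2 (qp_gelfand_model (W := W) [set s; t]),
          (4 %| m)%N -> has_exactly 8 (qp_gelfand_model (W := W) [set s; t])
        & (m %% 4 = 2)%N ->
            has_exactly 16 (qp_gelfand_model (W := W) [set s; t])]].
Proof.
have cardW : #|W| = (2 * m)%N by apply: (dihedral_presentation_card _ hW); lia.
case: hW => _ genW s2 t2 st_m.
have oddP := odd_modelP hm genW s2 t2 st_m cardW.
have evenP := even_modelP hm genW s2 t2 st_m cardW.
have odd2 := odd_model_has_exactly hm genW s2 t2 st_m cardW.
have refl4 := reflection_induced_has_exactly hm genW s2 t2 st_m cardW.
have even8 := even_model_has_exactly hm genW s2 t2 st_m cardW.
have extra8 := extra_model_has_exactly hm genW s2 t2 st_m cardW.
have disj := extra_not_even hm genW s2 t2 st_m cardW.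
split=> [m_odd|m_even|m2|].
- by split=> [M|]; [apply: oddP | apply: odd2].
- by split=> [M||]; [apply: evenP | apply: refl4 | apply: even8].
- by split=> [|M]; [apply: extra8 | apply: disj].
split=> [m_odd|m4|m2].
- by apply: has_exactly_iff (odd2 m_odd) => M; split=> /oddP; apply.
- have m_even : ~~ odd m by lia.
  apply: has_exactly_iff (even8 m_even) => M; split=> [evM|/evenP-/(_ m_even)[//|[]]].
    by apply/evenP=> //; left.
  by lia.
have m_even : ~~ odd m by lia.
apply: has_exactly_iff (has_exactly_or (even8 m_even) (extra8 m2) (disj m2)) => M.
split=> [[evM|exM]|/evenP-/(_ m_even)[evM|[_ exM]]]; by [apply/evenP => //; left
  | apply/evenP => //; right | left | right].
Qed.
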